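(* There is an absolute constant $C>0$ such that for every real $c$ with $0<c<1$ and every $n$, every graph $G$ on $n$ vertices with minimum degree $cn$ can be decomposed into at most $C c^{-12} n$ cycles and edges.
   Context: Graphs are finite and simple. A decomposition of a graph into cycles and edges is a partition of its edge set into sets each of which is either the edge set of a cycle or a single edge. *)

(* Defs.v *)
From mathcomp Require Import all_boot.

Set Implicit Arguments.
Unset Strict Implicit.
Unset Printing Implicit Defensive.

Record sgraph (T : finType) := SGraph {
  adj :> rel T;
  adj_sym : symmetric adj;
  adj_irrefl : irreflexive adj }.

Section Graph.
Variables (T : finType) (G : sgraph T).

Definition degree (x : T) : nat := #|[set y | G x y]|.

(* The default value #|T| bounds every degree, so this is the true minimum as *)
(* soon as T is nonempty; it is 0 for the graph without vertices.             *)
Definition min_degree : nat := \big[minn/#|T|]_(x : T) degree x.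

Definition edges : {set {set T}} :=
  [set [set x; y] | x in T, y in [set y | G x y]].

(* The vertices of the cycle are listed in cyclic order; [next s x] is the    *)
(* cyclic successor of x in s, and 2 < size s rules out closed walks that     *)
(* traverse a single vertex or a single edge.                                 *)
Definition is_cycle_edges (B : {set {set T}}) : Prop :=
  exists s : seq T,
    [/\ ucycle G s, 2 < size s & B = [set [set x; next s x] | x in s]].

Definition is_single_edge (B : {set {set T}}) : Prop :=
  exists2 E, E \in edges & B = [set E].

Definition cycle_edge_decomposition (P : {set {set {set T}}}) : Prop :=
  partition P edges /\
  forall B, B \in P -> is_cycle_edges B \/ is_single_edge B.

End Graph.

(* Main.v *)
Require Import Defs.
From mathcomp Require Import all_boot all_order all_algebra.
From mathcomp Require Import zify.
From mathcomp Require Import reals.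

(** Replace [c] by the integer [a], the least one above [1/c]: every vertex
has at least [n/a] neighbours, and [O(a^12 n)] pieces are allowed.  When [n] is
[O(a^7)] the single edges are few enough, so [n] may be taken large.

Closing paths.  A path together with an edge-disjoint walk of bounded length
joining its two ends is a closed walk, and it splits into boundedly many cycles
because the path itself repeats no vertex ([closed_walk_cycles]).  Every edge
set splits into [n] paths, possibly trivial, such that each vertex is an end of
at most three of them ([path_decomposition], proved with the exchange argument
that Lovasz used to decompose a graph into paths and cycles).  It is therefore
enough to set aside, for a fixed [c], a linear number of edges that offer each
vertex three private short walks to a hub, in such a way that both ends of each
path have walks to the same hub ([close_paths]); what is not used of them is
left as single edges.

Hubs.  Call two vertices near when they have at least [n/(8a^2)] common
neighbours.  Pairwise far vertices number at most [2a], as their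
neighbourhoods hardly overlap, and every vertex is near some member of a maximal
set of pairwise far vertices, which makes its members suitable as hubs
([hub_set_exists]).  But a hub has fewer than [n] edges, so it can only serve a
small proportion of the vertices.  For this reason the vertices are cut into
[O(a^2)] blocks, the edges are sorted by the pair of blocks that they join, and
each of the [O(a^4)] pairs receives hubs of its own; an edge is then attached to
a hub that is near to one of its ends and that only serves two blocks
([hub_assignment]).  The edges that meet hubs are single pieces, unless they belong to reserved walks.

Connecting walks.  Let [u] be an end of an edge attached to the hub [x].  If [u]
is near [x], there are many candidates for a walk [u - w - x].  Otherwise
all the neighbours [y] of [u] along edges attached to [x] are near [x].  If there
are few of them, these edges become pieces; if there are many, one looks
for walks [u - y - w - x].  No two such choices compete for the edge
[uy], since it determines [x], and [u] as its end far from [x].  Bounding how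
often a vertex serves as [y], which is possible as each [u] has many
candidates, leaves enough freedom to choose the vertices [w] greedily
([reserve_connectors]).

There are [O(a^5)] hubs; each of them accounts for [O(n)] cycles and [O(a^7 n)]
single edges. *)

Set Implicit Arguments.
Unset Strict Implicit.
Unset Printing Implicit Defensive.

(** * Decompositions into paths *)

Section Walks.
Variable T : finType.
Implicit Types (p q h r s : seq T) (Ps : seq (seq T)) (E : seq {set T}) (x y z u v : T).

Definition walk_edges p : seq {set T} :=
  [seq [set e.1; e.2] | e <- zip p (behead p)].

(** Edges are listed, and lists compared up to permutation: that some walks are
edge-disjoint and cover [E] is then one statement, [perm_eq (all_edges Ps) E]. *)
Definition all_edges Ps : seq {set T} := flatten (map walk_edges Ps).

Lemma walk_edges_cons2 x y p :
  walk_edges (x :: y :: p) = [set x; y] :: walk_edges (y :: p).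
Proof. by []. Qed.

Lemma walk_edges_cat p x y q :
  walk_edges (rcons p x ++ y :: q) =
  walk_edges (rcons p x) ++ [set x; y] :: walk_edges (y :: q).
Proof.
elim: p => [|a [|b p] IH] //.
by rewrite !rcons_cons !cat_cons !walk_edges_cons2 IH.
Qed.

Lemma walk_edges_rev p : perm_eq (walk_edges (rev p)) (walk_edges p).
Proof.
elim: p => [|a [|b p] IH] //.
rewrite 2!rev_cons -cats1 walk_edges_cat -rev_cons walk_edges_cons2.
by rewrite perm_catC /= setUC perm_cons.
Qed.

Lemma walk_edges_mid h y x r : [set x; y] \in walk_edges (h ++ y :: x :: r).
Proof.
by rewrite -cat_rcons walk_edges_cat mem_cat inE setUC eqxx orbT.
Qed.

Lemma mem_all_edges Ps p e : p \in Ps -> e \in walk_edges p ->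
  e \in all_edges Ps.
Proof. by move=> pP ep; apply/flattenP; exists (walk_edges p); rewrite ?map_f. Qed.

Lemma perm_all_edges Ps Qs : perm_eq Ps Qs ->
  perm_eq (all_edges Ps) (all_edges Qs).
Proof. by move=> ?; apply/perm_flatten/perm_map. Qed.

(** A path with a single vertex has both of its ends there, and counts twice. *)
Definition end_at p v : nat := (ohead p == Some v) + (ohead (rev p) == Some v).

Definition ends Ps v : nat := \sum_(p <- Ps) end_at p v.

Definition is_path p := uniq p && (p != [::]).

(** The flags lock the first and the last end of the path: the exchange argument
moves each end of a path at most once, and a lock records that it has moved. *)
Definition locked_path := (bool * seq T * bool)%type.
Implicit Types (L : seq locked_path) (b : locked_path).

Definition path_of b := b.1.2.
Definition flip b : locked_path := (b.2, rev b.1.2, b.1.1).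

Definition open_end b v : nat :=
  (~~ b.1.1 && (ohead b.1.2 == Some v)) +
  (~~ b.2 && (ohead (rev b.1.2) == Some v)).
Definition open_ends L v : nat := \sum_(b <- L) open_end b v.
Definition open_size L : nat := \sum_(b <- L) (~~ b.1.1 + ~~ b.2).

(** The edge joining [x] to the preceding or following vertex [y] of a path may be
dropped when the end on that side moves; another free end must then sit at [y]
to carry on.  Locked ends do not move, hence the restriction to free ones. *)
Definition supplied x L b : Prop :=
  (forall h y r, b.1.2 = h ++ y :: x :: r -> ~~ b.1.1 -> 0 < open_ends L y) /\
  (forall h y r, b.1.2 = h ++ x :: y :: r -> ~~ b.2 -> 0 < open_ends L y).

Definition insertable x z L : Prop :=
  [/\ all is_path (map path_of L),
      uniq ([set x; z] :: all_edges (map path_of L)), 0 < open_ends L z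
    & forall b, b \in L -> supplied x L b].

Lemma insertable_perm x z L L' : perm_eq L L' ->
  insertable x z L -> insertable x z L'.
Proof.
move=> pL [H1 H2 H3 H4].
have oE v : open_ends L' v = open_ends L v.
  by rewrite /open_ends; apply: perm_big; rewrite perm_sym.
split.
- by rewrite -(perm_all _ (perm_map _ pL)).
- by rewrite (perm_uniq (s2 := [set x; z] :: all_edges (map path_of L))) // perm_cons
    perm_sym perm_all_edges // perm_map.
- by rewrite oE.
- by move=> b; rewrite -(perm_mem pL) => /H4 []; split => *; rewrite oE; eauto.
Qed.

Lemma is_path_rev p : is_path (rev p) = is_path p.
Proof. by rewrite /is_path rev_uniq -!size_eq0 size_rev. Qed.

Lemma insertable_flip x z b L :
  insertable x z (b :: L) -> insertable x z (flip b :: L).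
Proof.
move=> [H1 H2 H3 H4].
have oE v : open_ends (flip b :: L) v = open_ends (b :: L) v.
  by rewrite /open_ends !big_cons /open_end /= revK [X in X + _ = _]addnC.
split.
- by rewrite /= /path_of /= is_path_rev.
- rewrite (perm_uniq (s2 := [set x; z] :: all_edges (map path_of (b :: L)))) //.
  by rewrite perm_cons /all_edges /= perm_cat2r walk_edges_rev.
- by rewrite oE.
- move=> b'; rewrite inE => /predU1P[->|b'L].
    have [P1 P2] := H4 _ (mem_head _ _).
    split=> h y r /(congr1 rev) /=; rewrite revK ?rev_cat ?rev_cons.
      by rewrite !cat_rcons => E ?; rewrite oE; apply: (P2 _ _ _ E).
    by rewrite !cat_rcons => E ?; rewrite oE; apply: (P1 _ _ _ E).
  have [] := H4 b'; first by rewrite inE b'L orbT.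
  by split=> *; rewrite oE; eauto.
Qed.

Lemma uniq_cat_inj x h1 h2 r1 r2 : uniq (h1 ++ x :: r1) ->
  h1 ++ x :: r1 = h2 ++ x :: r2 -> h1 = h2 /\ r1 = r2.
Proof.
elim: h1 h2 => [|a h1 IH] [|b h2] //= /andP[aN u] [E].
- by rewrite E.
- by move=> E2; rewrite E2 mem_cat mem_head orbT in aN.
- by move=> _; rewrite E mem_cat mem_head orbT in aN.
- by move=> /(IH _ u)[-> ->]; rewrite E.
Qed.

Lemma SomeE x y : (Some x == Some y) = (x == y).
Proof. by []. Qed.

(** To insert the edge [xz], pick a path with a free end at [z].  If it avoids [x],
prolong it to [x].  Otherwise it has the form [z ... z' x ...]; reversing its
part before [x] gives [z' ... z x ...], which uses [xz] instead of [xz'], and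
the edge [xz'] remains to be inserted.  The end that has moved from [z] to [z']
gets locked, so the process terminates, and by [supplied] a free end is still
available at [z'].  In total [z] loses an end and [x] gains one. *)
Lemma insert_edge_locked k x z L : open_size L < k -> insertable x z L -> z != x ->
  exists Ps, [/\ all is_path Ps,
    perm_eq (all_edges Ps) ([set x; z] :: all_edges (map path_of L)),
    size Ps = size L &
    forall v, ends Ps v + (v == z) = ends (map path_of L) v + (v == x)].
Proof.
elim: k z L => [//|k IH] z L szL insL zx.
(* Up to reversing the path, its free end at z is its head. *)
suff core b L' : open_size (b :: L') <= k -> insertable x z (b :: L') ->
    ~~ b.1.1 -> ohead b.1.2 = Some z ->
  exists Ps, [/\ all is_path Ps,
    perm_eq (all_edges Ps) ([set x; z] :: all_edges (map path_of (b :: L'))),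
    size Ps = (size L').+1 &
    forall v, ends Ps v + (v == z) = ends (map path_of (b :: L')) v + (v == x)].
  have [_ _ /[dup] zpos _ _] := insL.
  have [b bL bz] : exists2 b, b \in L & 0 < open_end b z.
    apply/hasP; apply: contraTT zpos; rewrite -all_predC -leqNgt => /allP noL.
    by rewrite /open_ends big1_seq // => b /= bL; have := noL b bL; rewrite /= -eqn0Ngt => /eqP.
  have pL := perm_to_rem bL; set L' := rem b L in pL.
  have szE : open_size (b :: L') = open_size L.
    by rewrite /open_size; apply: perm_big; rewrite perm_sym.
  have endE v : ends (map path_of (b :: L')) v = ends (map path_of L) v.
    by rewrite /ends; apply: perm_big; rewrite perm_sym perm_map.
  have sL : (size L').+1 = size L by rewrite (perm_size pL).
  have edE : perm_eq (all_edges (map path_of (b :: L'))) (all_edges (map path_of L)).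
    by rewrite perm_sym perm_all_edges // perm_map.
  have insb := insertable_perm pL insL.
  have [[b1 bzh]|[b2 bzl]] : (~~ b.1.1 /\ ohead b.1.2 = Some z) \/
      (~~ b.2 /\ ohead (rev b.1.2) = Some z).
    by move: bz; rewrite /open_end; case: (~~ b.1.1) => /=;
      case: (~~ b.2) => /=; do ?[case: (ohead _ =P _) => //= ?]; auto.
  - have [|||| Ps [P1 P2 P3 P4]] := core b L'; rewrite ?szE //.
    exists Ps; split => //; last by move=> v; rewrite P4 endE.
      by apply: (perm_trans P2); rewrite perm_cons.
    by rewrite P3.
  - have [|||| Ps [P1 P2 P3 P4]] := core (flip b) L' => //.
    + by rewrite -ltnS (leq_ltn_trans _ szL) // -szE /open_size !big_cons /= [X in X + _]addnC.
    + exact: insertable_flip.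
    exists Ps; split => //.
    + apply: (perm_trans P2); rewrite perm_cons; apply: perm_trans edE.
      by rewrite /all_edges /= perm_cat2r walk_edges_rev.
    + by rewrite P3.
    + move=> v; rewrite P4 -endE /ends !big_cons /end_at /path_of /= revK.
      by congr (_ + _ + _); rewrite addnC.
move=> {L szL insL} szL insL b1 bz.
have [isP edU zpos sup] := insL.
case: b b1 bz szL insL isP edU zpos sup => [[b1 p] b2] /= /negbTE -> {b1}.
case: p => [//|z0 p] /= [->] {z0} szL insL isP edU zpos sup.
have [xp|xp] := boolP (x \in z :: p); last first.
  exists ((x :: z :: p) :: map path_of L'); split.
  - by move: isP; rewrite /= /is_path /path_of /= !andbT xp.
  - by rewrite /all_edges /= perm_refl.
  - by rewrite /= size_map.
  - move=> v; rewrite /ends !big_cons /end_at /path_of /=.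
    rewrite rev_cons [ohead (rcons _ _)](_ : _ = ohead (rev (z :: p))).
      rewrite !SomeE [z == v]eq_sym [x == v]eq_sym.
      by move: (\sum_(i <- _) _) (_ == Some v) (v == z) (v == x); clear; lia.
    by rewrite rev_cons; case: (rev p).
have [h [r pE]] : exists h r, z :: p = h ++ x :: r.
  by case/splitPr: xp => h r; exists h, r.
case: (lastP h) pE => [|{}h z' pE]; first by case=> zx'; rewrite zx' eqxx in zx.
have up : uniq (rcons h z' ++ x :: r) by move: isP; rewrite -pE => /andP[/andP[]].
have zE : ohead (rcons h z') = Some z.
  by case: (h) pE => [|a h'] /= [->].
have zh : z \in rcons h z' by case: (rcons h z') zE => //= a s [->]; rewrite mem_head.
have [nz nE] : [set x; z] \notin all_edges (map path_of L') /\
     [set x; z] \notin walk_edges (z :: p).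
  move: edU; rewrite /all_edges /= => /andP[+ _].
  by rewrite mem_cat negb_or => /andP[].
have z'z : z' != z.
  apply: contraNneq nE => z'E; rewrite pE z'E cat_rcons; exact: walk_edges_mid.
have z'x : z' != x.
  by move: up; rewrite cat_uniq => /and3P[_ /hasPn/(_ x (mem_head _ _)) + _];
    rewrite mem_rcons inE negb_or eq_sym => /andP[].
pose L1 : seq locked_path := (true, rev (rcons h z') ++ x :: r, b2) :: L'.
pose L0 : seq locked_path := (false, z :: p, b2) :: L'.
have lastE w : ohead (rev (w ++ x :: r)) = ohead (rev (x :: r)).
  by rewrite rev_cat rev_cons; case: (rev r).
have last0 : ohead (rev (z :: p)) = ohead (rev (x :: r)) by rewrite pE lastE.
have oE v : open_ends L1 v + (v == z) = open_ends L0 v.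
  rewrite /open_ends !big_cons /open_end /= last0 lastE SomeE [z == v]eq_sym.
  by rewrite addnC addnA add0n.
have oE' v : v != z -> open_ends L1 v = open_ends L0 v.
  by move=> /negbTE vz; have := oE v; rewrite vz addn0.
have edE : perm_eq ([set x; z'] :: all_edges (map path_of L1))
                   ([set x; z] :: all_edges (map path_of L0)).
  rewrite /all_edges /= /path_of /= pE walk_edges_cat.
  have -> : rev (rcons h z') = rcons (rev (behead (rcons h z'))) z.
    by case: (rcons h z') zE => //= a s [->]; rewrite rev_cons.
  rewrite walk_edges_cat.
  have -> : rcons (rev (behead (rcons h z'))) z = rev (rcons h z').
    by case: (rcons h z') zE => //= a s [->]; rewrite rev_cons.
  apply/permP => P; rewrite /= !count_cat /= (permP (walk_edges_rev _)).
  rewrite (setUC [set z']) (setUC [set z]).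
  by move: (nat_of_bool _) (nat_of_bool _) (count _ _) (count _ _) (count _ _); clear; lia.
have [||//|Ps [P1 P2 P3 P4]] := IH z' L1.
- by move: szL; rewrite /L1 /open_size !big_cons /= add0n add1n addSn.
- split.
  + move: isP; rewrite /L1 /= /path_of /= {1 3}/is_path => /andP[_ ->].
    rewrite andbT -size_eq0 size_cat addnS andbT.
    rewrite -(perm_uniq (s1 := rcons h z' ++ x :: r)) //.
    by rewrite perm_cat2r perm_sym perm_rev.
  + by rewrite (perm_uniq edE).
  + rewrite oE' //.
    have [S _] := sup _ (mem_head _ _).
    by apply: (S h z' r) => //=; rewrite pE cat_rcons.
  + move=> b; rewrite inE => /predU1P[->|bL].
      split=> //= h1 y h2 E b2'.
      have [_ S] := sup _ (mem_head _ _).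
      have [_ E1] : rev (rcons h z') = h1 /\ r = y :: h2.
        apply: (uniq_cat_inj _ E); rewrite -(perm_uniq (s1 := rcons h z' ++ x :: r)) //.
        by rewrite perm_cat2r perm_sym perm_rev.
      rewrite oE'; first by apply: (S (rcons h z') y h2) => //=; rewrite pE E1.
      apply/eqP => yz; move: up; rewrite E1 cat_uniq => /and3P[_ /hasPn /(_ y)].
      by rewrite !inE eqxx orbT yz zh => /(_ isT).
    have [S1 S2] := sup b (mem_behead (s := (_ :: _)) bL).
    have bz : forall h y r, b.1.2 = h ++ y :: x :: r \/ b.1.2 = h ++ x :: y :: r -> y != z.
      move=> h1 y h2 E; apply: contraNneq nz => <-.
      apply: (@mem_all_edges _ b.1.2); first by rewrite -/(path_of b) map_f.
      by case: E => ->; rewrite ?walk_edges_mid // setUC walk_edges_mid.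
    split=> h1 y h2 E b'; rewrite oE'; eauto.
- exists Ps; split => //.
  + exact: perm_trans P2 edE.
  + move=> v; have := P4 v.
    rewrite /ends !big_cons /end_at /path_of /= last0 lastE rev_rcons /= !SomeE [z == v]eq_sym [z' == v]eq_sym.
    move: (\sum_(i <- _) _) (\sum_(i <- _) _) (v == z) (v == z') (v == x) (_ == Some v).
    clear; lia.
Qed.


(** With nothing locked, it is enough that each vertex is an end of some path. *)
Lemma insert_edge Ps x z : all is_path Ps -> uniq ([set x; z] :: all_edges Ps) ->
  z != x -> (forall v, 0 < ends Ps v) ->
  exists Qs, [/\ all is_path Qs,
    perm_eq (all_edges Qs) ([set x; z] :: all_edges Ps), size Qs = size Ps &
    forall v, ends Qs v + (v == z) = ends Ps v + (v == x)].
Proof.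
move=> isP uE zx pos; pose L := [seq (false, p, false) | p <- Ps].
have LE : map path_of L = Ps by rewrite -map_comp map_id.
have oE v : open_ends L v = ends Ps v by rewrite /open_ends big_map.
have [||//|Qs []] := @insert_edge_locked (open_size L).+1 x z L; first by [].
  split; rewrite ?LE ?oE //.
  by move=> b _; split=> h y r _ _; rewrite oE.
by rewrite LE size_map => *; exists Qs.
Qed.

Definition edge_degree E v := count (fun e : {set T} => v \in e) E.

Lemma sum_ends Ps : all is_path Ps -> \sum_v ends Ps v = (size Ps).*2.
Proof.
elim: Ps => [|p Ps IH] /=; first by rewrite big1 // => v _; rewrite /ends big_nil.
move=> /andP[/andP[_ pN] /IH {}IH].
under eq_bigr do rewrite /ends big_cons.
rewrite big_split /= IH doubleS -addn2 addnC; congr (_ + _).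
have one : forall q, q != [::] -> \sum_v (ohead q == Some v : nat) = 1.
  case=> // a q _; rewrite (bigD1 a) //= eqxx big1 // => v.
  by rewrite eq_sym => /negbTE va; rewrite SomeE va.
rewrite big_split /= !one //; by rewrite -size_eq0 size_rev size_eq0.
Qed.

(** Start from the trivial path at each vertex, which has both of its ends
there, and insert the edges one at a time, moving an end from one extremity of
the edge to the other.  The numbers of ends have the parity of the degrees, and
they stay between one and three if the edges come in a suitable order: an edge at
a vertex of odd degree is inserted last when there is one, so that this vertex
had two ends before; if all degrees are even, the extremities of the last edge
are the only odd vertices before, and since the average number of ends is two,
one of them had one end and the other three. *)
Theorem path_decomposition E : uniq E -> all (fun e : {set T} => #|e| == 2) E ->
  exists Ps, [/\ all is_path Ps, perm_eq (all_edges Ps) E, size Ps = #|T| &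
    forall v, 0 < ends Ps v <= 3 /\ odd (ends Ps v) = odd (edge_degree E v)].
Proof.
have [k] := ubnP (size E); elim: k E => [//|k IH] E szE uE E2.
(* It is enough to find an edge uv to be inserted last, such that an end can be
   moved between u and v without leaving the range from one to three. *)
suff choose u v E' : u != v -> perm_eq ([set u; v] :: E') E ->
   (forall Ps, all is_path Ps -> size Ps = #|T| ->
      (forall v, 0 < ends Ps v <= 3 /\ odd (ends Ps v) = odd (edge_degree E' v)) ->
      (1 < ends Ps u /\ ends Ps v < 3) \/ (1 < ends Ps v /\ ends Ps u < 3)) ->
   exists Ps, [/\ all is_path Ps, perm_eq (all_edges Ps) E, size Ps = #|T| &
    forall v, 0 < ends Ps v <= 3 /\ odd (ends Ps v) = odd (edge_degree E v)].
  have [/existsP[v vodd]|/existsPn allev] := boolP [exists v, odd (edge_degree E v)].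
    have /hasP[e eE ve] : has (fun e : {set T} => v \in e) E.
      by rewrite has_count -/(edge_degree E v); case: (edge_degree E v) vodd.
    have [u uv eE'] : exists2 u, v != u & e = [set v; u].
      have /cards2P[a [b [ab eab]]] := allP E2 e eE.
      move: ve; rewrite eab !inE => /orP[] /eqP->; first by exists b.
      by exists a; rewrite 1?eq_sym // setUC.
    have pE : perm_eq ([set v; u] :: rem e E) E.
      by rewrite -eE' perm_sym perm_to_rem.
    apply: (choose v u (rem e E)) => // Ps _ _ H.
    have [vb vp] := H v; have [ub _] := H u.
    have dv : edge_degree E v = (edge_degree (rem e E) v).+1.
      by rewrite /edge_degree -(permP pE) /= !inE eqxx.
    move: vp vb ub; move: vodd; rewrite dv /= => /negbTE ->.
    by case: (ends Ps v) (ends Ps u) => [|[|[|[|]]]] // [|[|[|[|]]]] //= *; auto.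
  case: E szE uE E2 choose allev IH => [|e E] szE uE E2 choose allev IH.
    exists [seq [:: v] | v <- enum T]; split.
    - by apply/allP => _ /mapP[v _ ->].
    - by rewrite /all_edges -map_comp; elim: (enum T).
    - by rewrite size_map cardE.
    move=> v; suff -> : ends [seq [:: v] | v <- enum T] v = 2 by [].
    rewrite /ends big_map big_enum /= (bigD1 v) //= big1 ?addn0.
      by rewrite /end_at /= SomeE eqxx.
    by move=> w /negbTE wv; rewrite /end_at /= SomeE wv.
  have /andP[/cards2P[u [v [uv eE]]] _] := E2.
  apply: (choose u v E) => //; rewrite -?eE // => Ps isP szP H.
  have ev w : w != u -> w != v -> ends Ps w = 2.
    move=> wu wv; have [+ /esym] := H w.
    have := allev w; rewrite /edge_degree /= eE !inE (negbTE wu) (negbTE wv) /=.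
    move=> /negbTE -> /esym.
    by case: (ends Ps w) => [|[|[|[|]]]].
  have od w : w \in [set u; v] -> odd (ends Ps w).
    move=> wuv; have [_ ->] := H w.
    by have := allev w; rewrite /edge_degree /= eE wuv /= negbK.
  have := sum_ends isP; rewrite szP.
  rewrite (bigD1 u) //= (bigD1 v) 1?eq_sym //= (eq_bigr (fun=> 2)); last first.
    by move=> w /andP[wu wv]; apply: ev.
  rewrite sum_nat_const => sE.
  have cE : #|T| = #|[pred i | (i != u) && (i != v)]| + 2.
    have := cardC [set u; v]; rewrite cards2 uv => <-; rewrite addnC; congr (_ + _).
    by apply: eq_card => w; rewrite !inE negb_or.
  move: sE; rewrite cE => sE.
  have suv : ends Ps u + ends Ps v = 4.
    apply: (@addIn (#|[pred i | (i != u) && (i != v)]| * 2)); rewrite -addnA sE.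
    by rewrite -muln2 mulnDl addnC.
  have := od u; have := od v; rewrite !inE !eqxx orbT => /(_ isT) + /(_ isT).
  move: suv; have [/andP[u0 u3] _] := H u; have [/andP[v0 v3] _] := H v.
  move: u0 u3 v0 v3.
  by case: (ends Ps v) (ends Ps u) => [|[|[|[|]]]] // [|[|[|[|]]]] //= *; auto.
move=> uv pE good.
have szE' : size E' < k by move: szE; rewrite -(perm_size pE).
have /andP[eN uE'] : uniq ([set u; v] :: E') by rewrite (perm_uniq pE).
have /andP[_ E2'] : all (fun e : {set T} => #|e| == 2) ([set u; v] :: E').
  by rewrite (perm_all _ pE).
have [Ps [isP pP szP H]] := IH E' szE' uE' E2'.
have posP w : 0 < ends Ps w by have [/andP[]] := H w.
have step z x : z != x -> [set x; z] = [set u; v] -> 1 < ends Ps z -> ends Ps x < 3 ->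
    exists Ps, [/\ all is_path Ps, perm_eq (all_edges Ps) E, size Ps = #|T| &
    forall v, 0 < ends Ps v <= 3 /\ odd (ends Ps v) = odd (edge_degree E v)].
  move=> zx xzE z2 x3.
  have [|//|//|Qs [Q1 Q2 Q3 Q4]] := @insert_edge Ps x z isP.
    by rewrite (perm_uniq (s2 := [set u; v] :: E')) ?xzE ?perm_cons //= eN.
  exists Qs; split=> //.
  - by apply: (perm_trans Q2); apply: perm_trans pE; rewrite xzE perm_cons.
  - by rewrite Q3.
  move=> w; have [/andP[w0 w3] wo] := H w; have := Q4 w.
  rewrite /edge_degree -(permP pE) /= -xzE !inE -/(edge_degree E' w) oddD -wo.
  have [->|wx] := eqVneq w x.
    by rewrite eq_sym (negbTE zx) addn0 => ->; rewrite addn1 /= x3.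
  have [wE|wz] := eqVneq w z.
    subst w; rewrite ?eqxx ?(negbTE zx) addn1 addn0 => eQ; move: z2 w3; rewrite -eQ /= negbK ltnS => -> Q3z.
    by rewrite (ltnW Q3z).
  by rewrite !addn0 => ->; rewrite w0 w3.
have [[]|[]] := good Ps isP szP H; first by apply: step; rewrite // setUC.
by apply: step; rewrite // eq_sym.
Qed.

(** * Closing paths into cycles *)

(** Appending the first vertex closes the walk, without a default vertex for the
empty list. *)
Definition cycle_edge_list s := walk_edges (s ++ take 1 s).
Definition is_long_cycle s := uniq s && (2 < size s).

Lemma walk_edges_split p x q :
  walk_edges (p ++ x :: q) = walk_edges (rcons p x) ++ walk_edges (x :: q).
Proof.
elim: p => [|a [|b p] IH] //.
by rewrite rcons_cons !cat_cons !walk_edges_cons2 -cat_cons IH.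
Qed.

(** Write [q = a :: q'].  If [a] does not occur in [p], it can be appended to [p]; if
it does, [p = p1 ++ a :: p2] and the cycle [a :: p2] splits off,
leaving the closed walk [rcons p1 a ++ q'].  Distinctness of the edges excludes
degenerate cycles with two vertices. *)
Lemma closed_walk_cycles q p : uniq p -> p != [::] ->
  uniq (cycle_edge_list (p ++ q)) ->
  all (fun e : {set T} => #|e| == 2) (cycle_edge_list (p ++ q)) ->
  exists Cs, [/\ all is_long_cycle Cs,
    perm_eq (flatten (map cycle_edge_list Cs)) (cycle_edge_list (p ++ q)) &
    size Cs <= (size q).+1].
Proof.
have cyc s : uniq s -> s != [::] -> uniq (cycle_edge_list s) ->
    all (fun e : {set T} => #|e| == 2) (cycle_edge_list s) -> is_long_cycle s.
  rewrite /is_long_cycle => ->; case: s => [|a [|b [|d s]]] //= _.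
    by rewrite setUid cards1.
  by rewrite setUC inE eqxx.
elim: q p => [|a q IH] p up p0.
  rewrite cats0 => uE aE; exists [:: p]; split=> //=; first by rewrite cyc.
  by rewrite cats0.
have [ap|ap] := boolP (a \in p); last first.
  rewrite -cat_rcons => uE aE.
  have [||//|//|Cs [C1 C2 C3]] := IH (rcons p a); first by rewrite rcons_uniq ap.
    by case: (p).
  by exists Cs; split=> //; apply: leqW.
case/splitPr: ap up {p0} => p1 p2 up.
set E := cycle_edge_list _ => uE aE.
have pE : perm_eq (cycle_edge_list (a :: p2) ++ cycle_edge_list (rcons p1 a ++ q)) E.
  rewrite /E /cycle_edge_list -!catA !cat_cons /= cat_rcons.
  have -> : take 1 (rcons p1 a ++ q) = take 1 (p1 ++ a :: p2 ++ a :: q).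
    by rewrite cat_rcons; case: (p1) => [|? ?]; rewrite /= !take0.
  move: (take 1 (p1 ++ _)) => c; rewrite take0.
  rewrite (walk_edges_split p1 a (q ++ c)) (walk_edges_split p1 a (p2 ++ _)).
  rewrite (walk_edges_split (a :: p2) a (q ++ c)) -cat_cons cats1.
  by rewrite perm_catCA.
have uE' := uE; rewrite -(perm_uniq pE) cat_uniq in uE'.
have aE' := aE; rewrite -(perm_all _ pE) all_cat in aE'.
case/and3P: uE' => u1 _ u2; case/andP: aE' => a1 a2.
have up1 : uniq (rcons p1 a).
  by move: up; rewrite -cat_rcons cat_uniq => /andP[].
have up2 : uniq (a :: p2) by move: up; rewrite cat_uniq => /and3P[].
have [||//|//|Cs [C1 C2 C3]] := IH (rcons p1 a) => //; first by case: (p1).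
exists ((a :: p2) :: Cs); split=> //=.
- by rewrite C1 cyc.
- by apply: perm_trans pE; rewrite perm_cat2l.
Qed.

Definition decomposable E k := exists Cs S, [/\ all is_long_cycle Cs,
  perm_eq (flatten (map cycle_edge_list Cs) ++ S) E & size Cs + size S <= k].

Lemma decomposable_perm E E' k : perm_eq E E' -> decomposable E k -> decomposable E' k.
Proof.
by move=> pE [Cs [S [H1 H2 H3]]]; exists Cs, S; split=> //; apply: perm_trans pE.
Qed.

Lemma decomposable_leq E k k' : k <= k' -> decomposable E k -> decomposable E k'.
Proof.
by move=> kk [Cs [S [H1 H2 H3]]]; exists Cs, S; split=> //; apply: leq_trans kk.
Qed.

Lemma decomposable_singles E : decomposable E (size E).
Proof. by exists [::], E. Qed.

Lemma decomposable_cat E E' k k' :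
  decomposable E k -> decomposable E' k' -> decomposable (E ++ E') (k + k').
Proof.
move=> [Cs [S [H1 H2 H3]]] [Cs' [S' [H1' H2' H3']]].
exists (Cs ++ Cs'), (S ++ S'); split.
- by rewrite all_cat H1.
- by rewrite map_cat flatten_cat perm_catACA perm_cat.
- by rewrite !size_cat addnACA leq_add.
Qed.

Definition connector_edges x (uc : T * seq T) := walk_edges (uc.1 :: rcons uc.2 x).

(** A path with a single vertex has no edge, and needs no connecting walk. *)
Definition proper_ends Ps v := ends [seq p <- Ps | 1 < size p] v.

(** Each pair [(u, c)] of [Cs] is a walk from [u] through [c] to the hub [x].  A path
from [u] to [v] consumes one such walk at each of its ends, and becomes a closed
walk with at most five vertices outside the path, hence at most six cycles. *)
Lemma close_paths x Ps (Cs : seq (T * seq T)) : all is_path Ps ->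
  (forall uc, uc \in Cs -> size uc.2 <= 2) ->
  (forall v, proper_ends Ps v <= count (fun uc => uc.1 == v) Cs) ->
  let E := all_edges Ps ++ flatten (map (connector_edges x) Cs) in
  uniq E -> all (fun e : {set T} => #|e| == 2) E ->
  decomposable E (6 * size Ps + 3 * size Cs).
Proof.
move: {-1}(size Ps) (leqnn (size Ps)) => k.
elim: Ps Cs k => [|p Ps IH] Cs k szk /= isP Cs2 cnt uE aE.
  apply: decomposable_leq (decomposable_singles _); rewrite /=.
  apply: leq_trans (leq_addl _ _).
  rewrite size_flatten /shape -map_comp.
  elim: Cs Cs2 {cnt uE aE} => [|uc Cs IH] //= Cs2.
  rewrite mulnS leq_add ?IH //; last by move=> ? H; apply: Cs2; rewrite inE H orbT.
  have := Cs2 uc (mem_head _ _).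
  by rewrite /connector_edges /walk_edges /= size_map size_zip /= size_rcons; move: (size uc.2); clear; lia.
case: k szk => // k; rewrite /= ltnS => szk; case/andP: isP => /andP[up p0] isP.
have [p1|p1] := ltnP 1 (size p); last first.
  have -> : all_edges (p :: Ps) = all_edges Ps.
    by case: p p1 {p0 up aE uE cnt} => [|a [|]].
  apply: decomposable_leq (IH Cs k _ isP Cs2 _ _ _) => //.
  - by rewrite leq_add2r leq_mul.
  - by move=> v; have := cnt v; rewrite /proper_ends /= ltnNge p1.
  - by move: uE; case: p p1 {p0 up aE cnt} => [|a [|]].
  - by move: aE; case: p p1 {p0 up uE cnt} => [|a [|]].
have [u [v [m pE]]] : exists u v m, p = u :: rcons m v.
  case: p p1 {p0 up aE uE cnt} => [|u p] //=; case: (lastP p) => // m v _.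
  by exists u, v, m.
have uv : u != v by move: up; rewrite pE /= mem_rcons inE negb_or => /andP[/andP[]].
have cntp w : proper_ends (p :: Ps) w = (w == u) + (w == v) + proper_ends Ps w.
  rewrite /proper_ends /= p1 /ends big_cons; congr (_ + _).
  rewrite /end_at pE /= rev_cons rev_rcons /= !SomeE.
  by rewrite [u == w]eq_sym [v == w]eq_sym.
have [[u' c1] uC /= /eqP u'E] : exists2 uc, uc \in Cs & uc.1 == u.
  apply/hasP; rewrite has_count; apply: leq_trans (cnt u).
  by rewrite cntp eqxx.
subst u'.
have pC1 := perm_to_rem uC; set C1 := rem _ _ in pC1.
have [[v' c2] vC /= /eqP v'E] : exists2 uc, uc \in C1 & uc.1 == v.
  apply/hasP; rewrite has_count; have := cnt v.
  by rewrite cntp eqxx (permP pC1) /= (negbTE uv) eq_sym (negbTE uv); apply: leq_trans.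
subst v'.
have pC2 := perm_to_rem vC; set C2 := rem _ _ in pC2.
have pC : perm_eq Cs ((u, c1) :: (v, c2) :: C2).
  by apply: (perm_trans pC1); rewrite perm_cons.
have C2s uc : uc \in C2 -> size uc.2 <= 2.
  by move=> H; apply: Cs2; rewrite (perm_mem pC) !inE H !orbT.
have c1s : size c1 <= 2 by apply: (Cs2 (u, c1)).
have c2s : size c2 <= 2 by apply: (Cs2 (v, c2)); rewrite (perm_mem pC) !inE eqxx orbT.
pose q := c2 ++ x :: rev c1.
set E := all_edges (p :: Ps) ++ _ in uE aE *.
set E2 := all_edges Ps ++ flatten (map (connector_edges x) C2).
have pE' : perm_eq (cycle_edge_list (p ++ q) ++ E2) E.
  have pe1 : perm_eq (cycle_edge_list (p ++ q))
      (walk_edges p ++ connector_edges x (u, c1) ++ connector_edges x (v, c2)).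
    have -> : cycle_edge_list (p ++ q) =
        walk_edges ((u :: m) ++ v :: (c2 ++ x :: (rev c1 ++ [:: u]))).
      by rewrite /cycle_edge_list /q pE /= take0 cat_rcons -!catA /= -!catA.
    rewrite walk_edges_split (walk_edges_split (v :: c2) x (rev c1 ++ _)).
    have -> : x :: rev c1 ++ [:: u] = rev (u :: rcons c1 x).
      by rewrite rev_cons rev_rcons cats1.
    rewrite pE -rcons_cons perm_cat2l perm_catC /connector_edges /= -rcons_cons.
    by rewrite perm_cat2r walk_edges_rev.
  apply: (perm_trans (perm_cat pe1 (perm_refl _))).
  have pf := perm_flatten (perm_map (connector_edges x) pC).
  rewrite perm_sym /E /E2 [all_edges (_ :: _)]/=.
  apply: (perm_trans (perm_cat (perm_refl _) pf)).
  rewrite /all_edges /= -!catA perm_cat2l !catA perm_cat2r.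
  by rewrite -catA perm_catC.
have uE' := uE; rewrite -(perm_uniq pE') cat_uniq in uE'.
have aE' := aE; rewrite -(perm_all _ pE') all_cat in aE'.
case/and3P: uE' => u1 _ u2; case/andP: aE' => a1 a2.
have [Ds [D1 D2 D3]] := closed_walk_cycles up p0 u1 a1.
apply: (decomposable_perm pE').
have sC : size Cs = (size C2).+2 by rewrite (perm_size pC).
apply: (@decomposable_leq _ (6 + (6 * k + 3 * size C2))).
  by rewrite sC; move: (size C2) => n; clear; lia.
apply: decomposable_cat.
  exists Ds, [::]; split=> //; first by rewrite cats0.
  by rewrite addn0 (leq_trans D3) // /q size_cat /= size_rev; move: (size c1) (size c2) c1s c2s; clear; lia.
apply: IH => // w; have := cnt w.
by rewrite cntp (permP pC) /= [u == w]eq_sym [v == w]eq_sym addnA leq_add2l.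
Qed.

End Walks.

(** * From lists of edges to partitions *)

Section Conversion.
Variables (T : finType) (G : sgraph T).

Lemma in_edges x y : ([set x; y] \in edges G) = G x y.
Proof.
apply/imset2P/idP => [[a b _]|xy]; last by exists x y; rewrite ?inE.
rewrite inE => ab E; have ba : b != a by apply: contraTneq ab => ->; rewrite adj_irrefl.
have xab : x \in [set a; b] by rewrite -E set21.
have axy : a \in [set x; y] by rewrite E set21.
have bxy : b \in [set x; y] by rewrite E set22.
move: xab axy bxy; rewrite !inE => /orP[] /eqP->.
  by rewrite (negbTE ba) => _ /eqP <-.
by rewrite eq_sym (negbTE ba) => /eqP <- _; rewrite adj_sym.
Qed.

Lemma card_edge e : e \in edges G -> #|e| == 2.
Proof.
case/imset2P => x y _; rewrite inE => xy ->; rewrite cards2.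
by case: (eqVneq x y) xy => [->|//]; rewrite adj_irrefl.
Qed.

Lemma path_walk_edges x p :
  {subset walk_edges (x :: p) <= edges G} -> path G x p.
Proof.
elim: p x => [|y p IH] x //= sub.
by rewrite -in_edges sub ?mem_head // IH // => e ep; rewrite sub // inE ep orbT.
Qed.

Lemma nth_walk_edges x e0 (p : seq T) i : i.+1 < size p ->
  nth e0 (walk_edges p) i = [set nth x p i; nth x p i.+1].
Proof. by elim: p i => [|a [|b p] IH] [|i] //=; apply: IH. Qed.

Lemma size_walk_edges (p : seq T) : size (walk_edges p) = (size p).-1.
Proof.
by rewrite size_map size_zip size_behead; case: (size p) => // k; apply/minn_idPr.
Qed.

Lemma cycle_edge_listE (s : seq T) : uniq s ->
  cycle_edge_list s = [seq [set x; next s x] | x <- s].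
Proof.
case: s => // x s us.
have szE : size (cycle_edge_list (x :: s)) = (size s).+1.
  by rewrite size_walk_edges size_cat /= take0 addn1.
apply: (@eq_from_nth _ set0) => [|i]; first by rewrite szE size_map.
rewrite szE => ilt.
have ilt2 : i.+1 < size ((x :: s) ++ take 1 (x :: s)).
  by rewrite size_cat /= take0 addn1.
rewrite [LHS](nth_walk_edges x _ ilt2).
rewrite (nth_map x) // next_nth mem_nth // index_uniq //.
rewrite [nth x (_ ++ _) i]nth_cat ilt; congr [set _; _].
rewrite /= take0 nth_cat; case: ltnP => // si; rewrite (nth_default _ si).
have -> : i = size s by apply/eqP; rewrite eqn_leq si andbT -ltnS.
by rewrite subnn.
Qed.

Lemma uniq_flatten_eq (S : eqType) (Bs : seq (seq S)) B B' e : uniq (flatten Bs) ->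
  B \in Bs -> B' \in Bs -> e \in B -> e \in B' -> B = B'.
Proof.
elim: Bs => // C Bs IH; rewrite /= cat_uniq => /and3P[_ /hasPn dis uBs].
rewrite !inE => /predU1P[->|BB] /predU1P[->|BB'] // eB eB'; last exact: IH.
- by have := dis e; rewrite (introT flattenP) ?eB; [move=> /(_ isT)|exists B'].
- by have := dis e; rewrite (introT flattenP) ?eB'; [move=> /(_ isT)|exists B].
Qed.

Lemma decomposable_partition k : decomposable (enum (edges G)) k ->
  exists2 P, cycle_edge_decomposition G P & #|P| <= k.
Proof.
move=> [Cs [S [cycCs pE szk]]].
pose Bs := map (@cycle_edge_list T) Cs ++ [seq [:: e] | e <- S].
have fE : flatten Bs = flatten (map (@cycle_edge_list T) Cs) ++ S.
  by rewrite flatten_cat; congr (_ ++ _); elim: (S) => //= e s ->.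
have mE e : (e \in flatten Bs) = (e \in edges G).
  by rewrite fE (perm_mem pE) mem_enum.
have uBs : uniq (flatten Bs) by rewrite fE (perm_uniq pE) enum_uniq.
have subB B e : B \in Bs -> e \in B -> e \in edges G.
  by move=> BB eB; rewrite -mE; apply/flattenP; exists B.
pose P := [set X in [seq [set e in B] | B <- Bs]] : {set {set {set T}}}.
have PP X : X \in P -> exists2 B, B \in Bs & X = [set e in B].
  by rewrite inE => /mapP[B BB ->]; exists B.
exists P; last first.
  apply: leq_trans szk; rewrite cardsE (leq_trans (card_size _)) //.
  by rewrite size_map size_cat !size_map.
split; last first.
  move=> _ /PP[B BB ->]; have := subB B; move: BB.
  rewrite mem_cat => /orP[] /mapP[]; last first.
    move=> e eS -> sub; right; exists e; first by apply: sub; rewrite ?mem_cat ?map_f ?orbT ?mem_head.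
    by apply/setP => e'; rewrite !inE.
  move=> s sC -> sub; left; exists s.
  have /andP[us s2] := allP cycCs _ sC.
  split=> //; last by apply/setP => e; rewrite cycle_edge_listE // inE;
     apply/mapP/imsetP => [[x]|[x]]; exists x.
  rewrite /ucycle us andbT; case: s sC us s2 sub => // x s sC us s2 sub /=.
  apply: path_walk_edges => e; rewrite -cats1 => eE; apply: sub.
    by rewrite map_f.
  by rewrite /cycle_edge_list /= take0.
apply/and3P; split.
- apply/eqP/setP => e; rewrite /cover -mE; apply/bigcupP/flattenP.
    by case=> X /PP[B BB ->]; rewrite inE; exists B.
  by case=> B BB eB; exists [set e in B]; rewrite inE // map_f.
- apply/trivIsetP => _ _ /PP[B BB ->] /PP[B' BB' ->]; apply: contraNT.
  case/pred0Pn => e /=; rewrite !inE => /andP[eB eB'].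
  by rewrite (uniq_flatten_eq uBs BB BB' eB eB').
- apply/negP => /PP[B BB] /setP E.
  suff [e eB] : exists e, e \in B by have := E e; rewrite !inE eB.
  move: BB; rewrite mem_cat => /orP[] /mapP[].
    move=> [|x [|y s]] sC -> //; have /andP[_] := allP cycCs _ sC => // _.
    by exists [set x; y]; rewrite mem_head.
  by move=> e _ ->; exists e; rewrite mem_head.
Qed.

End Conversion.

(** * Hubs *)

Lemma card_bigcup_leq (I S : finType) (A : {set I}) (F : I -> {set S}) k :
  (forall i, i \in A -> #|F i| <= k) -> #|\bigcup_(i in A) F i| <= #|A| * k.
Proof.
move=> Fk; rewrite -sum_nat_const; elim/big_rec2: _ => [|i j B iA IH]; first by rewrite cards0.
by rewrite (leq_trans (leq_card_setU _ _)) // leq_add // Fk.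
Qed.

Section Hubs.
Variables (T : finType) (G : sgraph T) (a : nat).
Hypothesis degG : forall v, #|T| <= a * degree G v.

Definition nbs v := [set y | G v y].
Definition codegree u v := #|nbs u :&: nbs v|.
Definition near u v := #|T| <= 8 * a ^ 2 * codegree u v.

Lemma near_refl v : near v v.
Proof.
rewrite /near /codegree setIid (leq_trans (degG v)) // leq_mul //.
case: (a) => // k; rewrite expnS mulnA -[X in X <= _]mul1n leq_mul // expn1; lia.
Qed.

Definition pairwise_far (A : {set T}) :=
  [forall x in A, forall y in A, (x != y) ==> ~~ near x y].

(** Consider [2a] vertices of a larger set.  Their degrees sum to at least [2n], but also,
counting the pairs in which a vertex is covered twice, to at most [n] plus the
sum of the [4a^2] codegrees, each below [n/(8a^2)]. *)
Lemma pairwise_far_card A : pairwise_far A -> #|A| <= 2 * a.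
Proof.
move=> /'forall_in_forall_inP farA; rewrite leqNgt; apply/negP => cA.
have [x0 x0A] : exists x0, x0 \in A by apply/card_gt0P; apply: leq_ltn_trans cA.
have T0 : 0 < #|T| by apply/card_gt0P; exists x0.
have a0 : 0 < a.
  rewrite lt0n; apply: contraTneq T0 => a0.
  by have := degG x0; rewrite a0 mul0n -leqNgt.
pose B := [set x in take (2 * a) (enum A)].
have cB : #|B| = 2 * a.
  rewrite cardsE (card_uniqP _) ?take_uniq ?enum_uniq //.
  by rewrite size_takel // -cardE ltnW.
have BA x : x \in B -> x \in A by rewrite inE => /mem_take; rewrite mem_enum.
pose pairs := \sum_(x in B) \sum_(y in B | y != x) codegree x y.
have le_pairs : \sum_(x in B) degree G x <= #|T| + pairs.
  have -> : \sum_(x in B) degree G x = \sum_(v : T) \sum_(x in B) G x v.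
    rewrite exchange_big; apply: eq_bigr => x _.
    rewrite /degree -sum1_card big_mkcond; apply: eq_bigr => v _ /=.
    by rewrite inE; case: (G x v).
  have -> : pairs = \sum_(v : T) \sum_(x in B) \sum_(y in B | y != x) (G x v && G y v).
    rewrite exchange_big; apply: eq_bigr => x _; rewrite exchange_big.
    apply: eq_bigr => y _; rewrite /codegree -sum1_card big_mkcond.
    by apply: eq_bigr => v _; rewrite !inE; case: (_ && _).
  rewrite -sum1_card -big_split /=; apply: leq_sum => v _.
  have [s1|s2] := leqP (\sum_(x in B) G x v) 1; first exact: leq_trans (leq_addr _ _).
  apply: leq_trans (leq_addl _ _); apply: leq_sum => x xB.
  case xv: (G x v) => //.
  move: s2; rewrite (bigD1 x) //= xv add1n ltnS.
  by [].
have le1 : 2 * #|T| <= \sum_(x in B) degree G x.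
  rewrite -(leq_pmul2l a0) big_distrr /=.
  apply: (@leq_trans (\sum_(x in B) #|T|)); last by apply: leq_sum => x _; apply: degG.
  by rewrite sum_nat_const cB mulnCA mulnA.
have le2 : 2 * pairs <= #|T|.
  have c0 : 0 < 4 * a ^ 2 by rewrite muln_gt0 expn_gt0 a0.
  rewrite -(leq_pmul2l c0) mulnA (_ : 4 * a ^ 2 * 2 = 8 * a ^ 2); last by lia.
  apply: (@leq_trans (\sum_(x in B) \sum_(y in B) #|T|)); last first.
    by rewrite !sum_nat_const cB; lia.
  rewrite big_distrr /=; apply: leq_sum => x xB.
  rewrite big_distrr /= [X in _ <= X](bigID (fun y => y != x)) /=.
  apply: leq_trans (leq_addr _ _); apply: leq_sum => y /andP[yB yx].
  have := farA x (BA x xB) y (BA y yB); rewrite eq_sym yx /= /near -ltnNge.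
  exact: ltnW.
move: le_pairs le1 le2 T0; clear; lia.
Qed.

(** A maximal set of pairwise far vertices outside [B] will do: a vertex that is far
from all of them could be added. *)
Lemma hub_set_exists (B : {set T}) : exists A : {set T},
  [/\ A \subset ~: B, #|A| <= 2 * a & forall v, v \notin B -> exists2 x, x \in A & near v x].
Proof.
pose P (A : {set T}) := (A \subset ~: B) && pairwise_far A.
have P0 : P set0.
  by rewrite /P sub0set; apply/forall_inP => x; rewrite inE.
have [A /maxsetP[/andP[AB farA] maxA] _] := maxset_exists P0.
exists A; split=> //; first exact: pairwise_far_card.
move=> v vB; apply/exists_inP; apply: contraT => /exists_inPn no.
have vA : v \notin A by apply: contraT => /negbNE/no; rewrite near_refl.
suff PvA : P (v |: A) by rewrite -(maxA _ PvA (subsetUr _ _)) setU11 in vA.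
rewrite /P subUset AB sub1set inE vB /=; apply/forall_inP => x xvA.
apply/forall_inP => y yvA; apply/implyP; move: xvA yvA.
rewrite !inE => /predU1P[->|xA] /predU1P[->|yA]; first by rewrite eqxx.
- by move=> _; apply: no.
- by move=> _; rewrite /near /codegree setIC; apply: no.
- by move/forall_inP: farA => /(_ x xA)/forall_inP/(_ y yA)/implyP.
Qed.

(** Iterating [hub_set_exists], each time excluding the hubs already chosen,
makes the sets of hubs disjoint: a hub then serves a single index. *)
Lemma hub_family (I : finType) : exists A : I -> {set T},
  [/\ forall i, #|A i| <= 2 * a, forall i j x, x \in A i -> x \in A j -> i = j &
   forall i v, (forall j, v \notin A j) -> exists2 x, x \in A i & near v x].
Proof.
have [f fP] := fin_all_exists hub_set_exists.
pose U := fix U k := if k is k'.+1 then U k' :|: f (U k') else set0.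
have Umono j k : j < k -> f (U j) \subset U k.
  elim: k => // k IH; rewrite ltnS leq_eqVlt => /predU1P[->|/IH sub] /=.
    exact: subsetUr.
  exact: subset_trans sub (subsetUl _ _).
exists (fun i => f (U (enum_rank i))); split.
- by move=> i; have [] := fP (U (enum_rank i)).
- move=> i j x xi xj; apply/enum_rank_inj/val_inj => /=.
  have lt k l : x \in f (U k) -> x \in f (U l) -> ~~ (k < l).
    move=> xk xl; apply/negP => /Umono /subsetP/(_ x xk) xU.
    by have [/subsetP/(_ x xl)] := fP (U l); rewrite inE xU.
  by case: ltngtP (lt _ _ xi xj) (lt _ _ xj xi).
- move=> i v vN; have [_ _ ex] := fP (U (enum_rank i)); apply: ex.
  have : enum_rank i <= #|I| by apply: ltnW.
  elim: (enum_rank i : nat) => [|k IH] klt /=; first by rewrite inE.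
  rewrite inE negb_or IH ?(ltnW klt) //=.
  by have := vN (enum_val (Ordinal klt)); rewrite enum_valK.
Qed.

(** The index of an edge is the pair of blocks that it joins, and its hub is taken
among those of this index.  As a hub belongs to one index, the
edges attached to it only meet two blocks.  The vertex [x00] is a
default value for [hub]. *)
Lemma hub_assignment (x00 : T) r : 0 < r -> exists (X : {set T}) (hub : {set T} -> T),
  [/\ #|X| <= r ^ 2 * (2 * a),
   forall u v, u \notin X -> hub [set u; v] \in X /\
      (near u (hub [set u; v]) || near v (hub [set u; v])) &
   forall x, x \in X -> #|[set u | [exists v, (u \notin X) && (hub [set u; v] == x)]]|
     <= 2 * (#|T| %/ r).+1].
Proof.
case: r => // r _; set n := #|T|.
pose blk (u : T) : 'I_r.+1 := inord (enum_rank u %% r.+1).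
have cblk b : #|[set u | blk u == b]| <= (n %/ r.+1).+1.
  rewrite -[X in _ <= X]card_ord.
  have lt_div (u : T) : enum_rank u %/ r.+1 < (n %/ r.+1).+1.
    by rewrite ltnS leq_div2r // ltnW.
  apply: (@leq_trans #|[set Ordinal (lt_div u) | u in [set u | blk u == b]]|); last exact: max_card.
  rewrite card_in_imset // => u v; rewrite !inE => /eqP ub /eqP vb [E].
  apply/enum_rank_inj/val_inj; rewrite /= (divn_eq (enum_rank u) r.+1) E.
  rewrite [X in _ = X](divn_eq (enum_rank v) r.+1); congr (_ + _).
  by rewrite -(@inordK r (_ %% _)) ?ltn_pmod // -/(blk u) ub -vb /blk inordK ?ltn_pmod.
pose I := ('I_r.+1 * 'I_r.+1)%type.
have [A [cA disA nearA]] := hub_family I.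
(* Any ordered pair listing the blocks met by e; since it depends on e only, the
   hub of an edge does not depend on an order of its ends. *)
pose cls (e : {set T}) : I := odflt (ord0, ord0) [pick t : I | blk @: e == [set t.1; t.2]].
have clsP u v : [set blk u; blk v] = [set (cls [set u; v]).1; (cls [set u; v]).2].
  rewrite /cls; case: pickP => [t /eqP <-|/(_ (blk u, blk v))]; first by rewrite imsetU1 imset_set1.
  by rewrite imsetU1 imset_set1 eqxx.
pose X := \bigcup_(t in [set: I]) A t.
have XA v t : v \notin X -> v \notin A t.
  by apply: contra => vA; apply/bigcupP; exists t.
pose hub (e : {set T}) : option T := [pick x in A (cls e) | [exists u in e, near u x]].
exists X, (fun e => odflt x00 (hub e)).
have hubP u v : u \notin X -> exists2 x, hub [set u; v] = Some x &
    x \in A (cls [set u; v]) /\ (near u x || near v x).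
  move=> uX; rewrite /hub; case: pickP => [x /andP[xA /exists_inP[w]]|].
    by rewrite !inE => /orP[] /eqP -> nx; exists x; rewrite ?nx ?orbT.
  have [x xA ux] := nearA (cls [set u; v]) u (fun t => XA u t uX).
  move=> /(_ x); rewrite xA /= => /existsP[]; exists u; by rewrite set21.
split.
- have -> : r.+1 ^ 2 * (2 * a) = #|[set: I]| * (2 * a).
    by rewrite cardsT card_prod !card_ord mulnn.
  by apply: card_bigcup_leq => t _; apply: cA.
- move=> u v /hubP-/(_ v)[x -> [xA nx]]; split=> //=.
  by apply/bigcupP; exists (cls [set u; v]).
- move=> x /bigcupP[t _ xt].
  apply: (@leq_trans #|[set u | blk u == t.1] :|: [set u | blk u == t.2]|); last first.
    by rewrite (leq_trans (leq_card_setU _ _)) // mul2n -addnn leq_add.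
  apply/subset_leq_card/subsetP => u; rewrite !inE => /existsP[v /andP[uX]].
  have [x' -> [x'A _]] := hubP u v uX => /= /eqP x'x; rewrite x'x in x'A.
  rewrite (disA _ _ _ xt x'A); have := set21 (blk u) (blk v).
  by rewrite clsP !inE.
Qed.

End Hubs.

(** * Reserving the connecting walks *)

Lemma greedy_choice (D A : eqType) (ok : D -> A -> bool)
    (compat : D -> A -> D -> A -> bool) (f0 : D -> A) (s : seq D) :
  (forall d a d' a', compat d a d' a' = compat d' a' d a) -> uniq s ->
  (forall s' f d, uniq (d :: s') -> {subset d :: s' <= s} ->
     (forall e, e \in s' -> ok e (f e)) ->
     (forall e e', e \in s' -> e' \in s' -> e != e' -> compat e (f e) e' (f e')) ->
     exists2 a, ok d a & forall e, e \in s' -> compat d a e (f e)) ->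
  exists f, (forall e, e \in s -> ok e (f e)) /\
    (forall e e', e \in s -> e' \in s -> e != e' -> compat e (f e) e' (f e')).
Proof.
move=> csym; elim: s => [|d s IH] us ext; first by exists f0.
have /andP[ds us'] := us.
have [|f [fok fcp]] := IH us'.
  move=> s' f d' u' sub; apply: ext => // e es.
  by rewrite inE sub ?orbT.
have [a aok acp] := ext s f d us (fun e H => H) fok fcp.
exists (fun e => if e == d then a else f e); split=> [e|e e']; rewrite !inE.
  by have [->|_] := eqVneq e d; last exact: fok.
have [->|ed] := eqVneq e d; have [->|e'd] := eqVneq e' d => //=.
- by move=> _ e's _; apply: acp.
- by move=> es _ _; rewrite csym; apply: acp.
- exact: fcp.
Qed.

Lemma exists_avoiding (A : finType) (S : {set A}) (l : seq A) :
  size l < #|S| -> exists2 a, a \in S & a \notin l.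
Proof.
move=> lS; apply/exists_inP; apply: contraT => /exists_inPn no.
have : #|S| <= size l.
  apply: leq_trans (card_size l); apply/subset_leq_card/subsetP => a aS.
  by have := no a aS; rewrite negbK.
by rewrite leqNgt lS.
Qed.

Lemma size_leq_card (D : eqType) (B : finType) (g : D -> B) (s : seq D) (S : {set B}) :
  uniq s -> {in s &, injective g} -> (forall d, d \in s -> g d \in S) -> size s <= #|S|.
Proof.
move=> us inj sub; rewrite -(size_map g) cardE; apply: uniq_leq_size.
  by rewrite map_inj_in_uniq.
by move=> _ /mapP[d ds ->]; rewrite mem_enum sub.
Qed.

Lemma set2_eq (T : finType) (a b c d : T) : [set a; b] = [set c; d] ->
  (a = c /\ b = d) \/ (a = d /\ b = c).
Proof.
move=> E.
have /set2P ha : a \in [set c; d] by rewrite -E set21.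
have /set2P hb : b \in [set c; d] by rewrite -E set22.
have /set2P hc : c \in [set a; b] by rewrite E set21.
have /set2P hd : d \in [set a; b] by rewrite E set22.
by case: ha hb hc hd => -> [->|->] [] ? [] ?; auto.
Qed.

Lemma perm_flatten_filter (S I : eqType) (g : S -> I) (xs : seq I) (s : seq S) :
  uniq xs -> (forall e, e \in s -> g e \in xs) ->
  perm_eq (flatten [seq [seq e <- s | g e == x] | x <- xs]) s.
Proof.
move=> uxs; suff H : perm_eq (flatten [seq [seq e <- s | g e == x] | x <- xs]) [seq e <- s | g e \in xs].
  by move=> sub; apply: (perm_trans H); rewrite (all_filterP _) //; apply/allP.
elim: xs uxs => [|x xs IH] /=; first by rewrite filter_pred0.
case/andP=> xN /IH {}IH; apply: (@perm_trans _ ([seq e <- s | g e == x] ++ [seq e <- s | g e \in xs])).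
  by rewrite perm_cat2l.
elim: s {IH} => //= e s IH; rewrite in_cons.
have [->|_] := eqVneq (g e) x; first by rewrite (negbTE xN) /= perm_cons.
case: (g e \in xs) => //=; by rewrite -[e :: _ in X in perm_eq X _]cat1s perm_catCA /= perm_cons.
Qed.

Lemma perm_flatten_cat (S I : eqType) (f g : I -> seq S) (xs : seq I) :
  perm_eq (flatten [seq f x ++ g x | x <- xs])
    (flatten (map f xs) ++ flatten (map g xs)).
Proof. by elim: xs => //= x xs IH; rewrite perm_sym perm_catACA perm_cat2l perm_sym. Qed.

Lemma decomposable_flatten (T : finType) (I : eqType) (f : I -> seq {set T}) k (xs : seq I) :
  (forall x, x \in xs -> decomposable (f x) k) ->
  decomposable (flatten (map f xs)) (size xs * k).
Proof.
elim: xs => [|x xs IH] H /=; first exact: decomposable_singles.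
rewrite mulSn; apply: decomposable_cat; first by apply: H; rewrite mem_head.
by apply: IH => y ys; apply: H; rewrite inE ys orbT.
Qed.

Lemma uniq_flatten_mem (S I : eqType) (f : I -> seq S) (xs : seq I) x :
  uniq (flatten (map f xs)) -> x \in xs -> uniq (f x).
Proof.
elim: xs => //= y xs IH; rewrite cat_uniq => /and3P[uy _ uxs].
by rewrite inE => /predU1P[->//|]; apply: IH.
Qed.

Lemma end_at_edge (T : finType) (p : seq T) v : 1 < size p -> 0 < end_at p v ->
  exists2 e, e \in walk_edges p & v \in e.
Proof.
have headE q : 1 < size q -> ohead q = Some v -> exists2 e, e \in walk_edges q & v \in e.
  by case: q => [|b [|c q]] //= _ [->]; exists [set v; c]; rewrite ?mem_head ?set21.
move=> p1; rewrite /end_at addn_gt0 !lt0b => /orP[] /eqP; first exact: headE.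
case/(headE (rev p)); first by rewrite size_rev.
by move=> e; rewrite (perm_mem (walk_edges_rev p)); exists e.
Qed.

(** Here [h] bounds the number of hubs, [m] the number of vertices served by a hub,
[slots] the number of times a vertex may be chosen as the second vertex [y] of a
walk [u - y - w - x], [heavy] the number of candidates for [y] that [u] must have for
such walks to be reserved, and [common] is exceeded by the codegree of near
vertices. *)
Section Reserve.
Variables (T : finType) (G : sgraph T) (X : {set T}) (hub : {set T} -> T).
Variables (near : rel T) (h m slots heavy common : nat).
Hypothesis nearP : forall u x, near u x -> common < codegree G u x.
Hypothesis cardX : #|X| <= h.
Hypothesis hub_near : forall u v, u \notin X ->
  hub [set u; v] \in X /\ (near u (hub [set u; v]) || near v (hub [set u; v])).
Hypothesis hub_load : forall x, x \in X ->
  #|[set u | [exists v, (u \notin X) && (hub [set u; v] == x)]]| <= m.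
Hypothesis slots_gt0 : 0 < slots.
Hypothesis heavy_big : 3 * (h * #|T|) + 3 * slots < heavy * slots.
Hypothesis common_big : 3 * m + 2 * slots + 8 * h <= common.

Definition out x u := [set y | [&& G u y, u \notin X, y \notin X & hub [set u; y] == x]].

(** Vertices [u] which may be ends of paths to be closed through [x]. *)
Definition active x u :=
  [&& x \in X, out x u != set0 & near u x || (heavy <= #|out x u|)].

(** The demand [(x, u, c)] asks for the [c]-th walk from [u] to the hub [x]; three
of them are needed since a vertex is an end of at most three paths. *)
Definition demand := (T * T * 'I_3)%type.
Implicit Types (d e : demand).

Definition demands : seq demand := [seq d <- enum {: demand} | active d.1.1 d.1.2].

Lemma demandsP d : d \in demands -> [/\ d.1.1 \in X, d.1.2 \notin X,
  exists y, y \in out d.1.1 d.1.2 & near d.1.2 d.1.1 || (heavy <= #|out d.1.1 d.1.2|)].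
Proof.
rewrite mem_filter => /andP[/and3P[xX /set0Pn[y yo] H] _]; split=> //.
  by move: yo; rewrite inE => /and4P[].
by exists y.
Qed.

Lemma uniq_demands : uniq demands. Proof. by rewrite filter_uniq ?enum_uniq. Qed.

Lemma demand_ext d e : d.1.1 = e.1.1 -> d.1.2 = e.1.2 -> d.2 = e.2 -> d = e.
Proof. by case: d e => [[x u] c] [[x' u'] c'] /= -> -> ->. Qed.

Lemma demands_card s : uniq s -> {subset s <= demands} -> size s <= 3 * (h * #|T|).
Proof.
move=> us sub.
apply: (@leq_trans #|[set d : demand | d.1.1 \in X]|).
  by apply: (@size_leq_card _ _ id) => // d /sub/demandsP[]; rewrite inE.
have -> : [set d : demand | d.1.1 \in X] = setX (setX X setT) setT.
  by apply/setP => d; rewrite !inE !andbT.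
by rewrite !cardsX !cardsT card_ord mulnC leq_mul // leq_mul.
Qed.

Lemma demands_at_vertex v s : uniq s -> {subset s <= demands} ->
  count (fun e => e.1.2 == v) s <= 3 * h.
Proof.
move=> us sub; rewrite -size_filter.
apply: (@leq_trans #|setX X [set: 'I_3]|); last first.
  by rewrite cardsX cardsT card_ord mulnC leq_mul.
apply: (@size_leq_card _ _ (fun e => (e.1.1, e.2))); first exact: filter_uniq.
  move=> d e; rewrite !mem_filter => /andP[/eqP dv _] /andP[/eqP ev _] [? ?].
  by apply: demand_ext; rewrite ?dv.
by move=> d; rewrite mem_filter => /andP[_ /sub/demandsP[xX _ _ _]]; rewrite !inE xX.
Qed.

Lemma demands_at_hub x s : x \in X -> uniq s -> {subset s <= demands} ->
  count (fun e => e.1.1 == x) s <= 3 * m.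
Proof.
move=> xX us sub; rewrite -size_filter.
pose V := [set u | [exists v, (u \notin X) && (hub [set u; v] == x)]].
apply: (@leq_trans #|setX V [set: 'I_3]|); last first.
  by rewrite cardsX cardsT card_ord mulnC leq_mul // hub_load.
apply: (@size_leq_card _ _ (fun e => (e.1.2, e.2))); first exact: filter_uniq.
  move=> d e; rewrite !mem_filter => /andP[/eqP dv _] /andP[/eqP ev _] [? ?].
  by apply: demand_ext; rewrite ?dv.
move=> d; rewrite mem_filter => /andP[/eqP dx /sub/demandsP[_ uX [y yo] _]].
rewrite !inE andbT; apply/existsP; exists y; rewrite uX.
by move: yo; rewrite inE dx => /and4P[].
Qed.

(** The demands that need a walk of length three. *)
Definition far_demands := [seq d <- demands | ~~ near d.1.2 d.1.1].

(** The second vertex of the walk is chosen together with one of its [slots], and the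
chosen pairs are all distinct: this bounds the load of each vertex.  The
three walks of the same [u] and [x] moreover need distinct second vertices. *)
Lemma choose_carriers : exists f : demand -> T * 'I_slots,
  (forall d, d \in far_demands -> (f d).1 \in out d.1.1 d.1.2) /\
  (forall d e, d \in far_demands -> e \in far_demands -> d != e ->
     f d != f e /\ (d.1 = e.1 -> (f d).1 != (f e).1)).
Proof.
pose compat d (a : T * 'I_slots) e (b : T * 'I_slots) :=
  (a != b) && ((d.1 == e.1) ==> (a.1 != b.1)).
pose ok d (a : T * 'I_slots) := a.1 \in out d.1.1 d.1.2.
have [||s f d uds sub fok fcp|f [fok fcp]] := @greedy_choice _ _ ok compat
    (fun d => (d.1.1, Ordinal slots_gt0)) far_demands.
- by move=> d a e b; rewrite /compat eq_sym [d.1 == _]eq_sym [a.1 == _]eq_sym.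
- exact: filter_uniq uniq_demands.
- pose l := [seq f e | e <- s] ++
     [seq ((f (d.1, c)).1, i) | c <- enum 'I_3, i <- enum 'I_slots].
  have dD : d \in demands by have := sub d (mem_head _ _); rewrite mem_filter => /andP[].
  have farK : heavy <= #|out d.1.1 d.1.2|.
    have := sub d (mem_head _ _); rewrite mem_filter => /andP[nd /demandsP[_ _ _]].
    by rewrite (negbTE nd).
  have szl : size l < #|setX (out d.1.1 d.1.2) [set: 'I_slots]|.
    rewrite cardsX cardsT card_ord size_cat size_map size_allpairs !size_enum_ord.
    apply: leq_trans (leq_mul farK (leqnn _)); apply: leq_ltn_trans heavy_big.
    rewrite leq_add2r demands_card //; first by case/andP: uds.
    by move=> e es; have := sub e; rewrite inE es orbT mem_filter => /(_ isT)/andP[].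
  have [a] := exists_avoiding szl; rewrite inE => /andP[a1 _] al.
  exists a => // e es; apply/andP; split.
    by apply: contraNneq al => ->; rewrite mem_cat map_f.
  apply/implyP => /eqP de; apply: contraNneq al => ae.
  rewrite mem_cat; apply/orP; right; apply/allpairsP; exists (e.2, a.2).
  by rewrite !mem_enum /= de -surjective_pairing -ae -surjective_pairing.
exists f; split=> // d e dF eF de.
have /andP[H1 /implyP H2] := fcp d e dF eF de.
by split=> // /eqP.
Qed.

(** The second vertices being fixed, the vertices [w] preceding the hub are chosen
greedily.  Call carrier the vertex before [w]: it is near the hub.  A common
neighbour [w] of the carrier and the hub is excluded in six cases besides
being a hub: it is already joined to the hub [x]; it is already joined to the
carrier by an earlier choice, where the carrier played the same role for a vertex
near its hub, the same role for a far vertex, or the role of [w];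
or it is joined to the carrier by an edge from a far vertex to its second
vertex, in either direction.  In each case the number of excluded vertices is
bounded; the third role occurs at most once per hub, as the edges into a hub
are distinct. *)
Lemma reserve_connectors : exists conn : demand -> seq T,
  [/\ forall d, size (conn d) <= 2,
   uniq (flatten [seq connector_edges d.1.1 (d.1.2, conn d) | d <- demands]) &
   {subset flatten [seq connector_edges d.1.1 (d.1.2, conn d) | d <- demands]
      <= edges G}].
Proof.
have [f1 [f1ok f1cp]] := choose_carriers.
pose y d := (f1 d).1.
pose carrier d := if near d.1.2 d.1.1 then d.1.2 else y d.
have farP d : d \in demands -> ~~ near d.1.2 d.1.1 -> d \in far_demands.
  by move=> dD nd; rewrite mem_filter nd.
have far_sub : {subset far_demands <= demands} by move=> d; rewrite mem_filter => /andP[].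
have yP d : d \in far_demands -> [/\ G d.1.2 (y d), d.1.2 \notin X, y d \notin X,
     hub [set d.1.2; y d] = d.1.1 & near (y d) d.1.1].
  move=> dF; have := f1ok d dF; rewrite inE => /and4P[Guy uX yX /eqP hE]; split=> //.
  have [_] := hub_near (y d) uX; rewrite -/(y d) hE.
  by move: dF; rewrite mem_filter => /andP[/negbTE ->].
have carX d : d \in demands -> carrier d \notin X.
  move=> dD; rewrite /carrier; case: ifPn => nd; first by have [] := demandsP dD.
  by have [] := yP d (farP d dD nd).
have car_near d : d \in demands -> near (carrier d) d.1.1.
  move=> dD; rewrite /carrier; case: ifPn => // nd.
  by have [] := yP d (farP d dD nd).
have loadP v s : uniq s -> {subset s <= far_demands} ->
    count (fun e => y e == v) s <= slots.
  move=> us sub; rewrite -size_filter -[X in _ <= X]card_ord -cardsT.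
  apply: (@size_leq_card _ _ (fun e => (f1 e).2)); first exact: filter_uniq.
    move=> d e; rewrite !mem_filter => /andP[/eqP yd /sub dF] /andP[/eqP ye /sub eF] E.
    apply/eqP; apply: contraT => /(f1cp d e dF eF)[/eqP[]]; rewrite /y in yd ye.
    by rewrite [f1 d]surjective_pairing [f1 e]surjective_pairing yd ye E.
  by move=> d _; rewrite inE.
(* the edges from the far vertices to the second vertices *)
pose R1 := [seq [set e.1.2; y e] | e <- far_demands].
pose ok d w := [&& w \in nbs G (carrier d) :&: nbs G d.1.1, w \notin X &
   [set carrier d; w] \notin R1].
pose compat d w e w' := ((d.1.1 == e.1.1) ==> (w != w')) &&
   ([set carrier d; w] != [set carrier e; w']).
have [||s f d uds sub fok fcp|f [fok fcp]] := @greedy_choice _ _ ok compat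
    (fun d => d.1.1) demands.
- by move=> d a e b; rewrite /compat eq_sym [a == _]eq_sym [[set _; a] == _]eq_sym.
- exact: uniq_demands.
- have dD : d \in demands by apply: sub; rewrite mem_head.
  have [xX uX _ _] := demandsP dD.
  have us : uniq s by case/andP: uds.
  have subs : {subset s <= demands} by move=> e es; apply: sub; rewrite inE es orbT.
  have uF : uniq far_demands := filter_uniq _ uniq_demands.
  set k := carrier d.
  pose B1 := [seq f e | e <- s & e.1.1 == d.1.1].
  pose B2 := [seq f e | e <- s & e.1.2 == k].
  pose B3 := [seq f e | e <- [seq e <- s | ~~ near e.1.2 e.1.1] & y e == k].
  pose B4 := [seq carrier e | e <- s & f e == k].
  pose B5 := [seq y e | e <- far_demands & e.1.2 == k].
  pose B6 := [seq e.1.2 | e <- far_demands & y e == k].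
  pose l := B1 ++ B2 ++ B3 ++ B4 ++ B5 ++ B6 ++ enum X.
  have szl : size l < #|nbs G k :&: nbs G d.1.1|.
    apply: leq_ltn_trans (nearP (car_near d dD)); apply: leq_trans common_big.
    have b1 : size B1 <= 3 * m by rewrite size_map size_filter demands_at_hub.
    have b2 : size B2 <= 3 * h by rewrite size_map size_filter demands_at_vertex.
    have b3 : size B3 <= slots.
      rewrite size_map size_filter loadP ?filter_uniq //.
      by move=> e; rewrite mem_filter => /andP[ne /subs eD]; apply: farP.
    have b4 : size B4 <= h.
      rewrite size_map; apply: leq_trans cardX.
      apply: (@size_leq_card _ _ (fun e => e.1.1)); first exact: filter_uniq.
        move=> e e'; rewrite !mem_filter => /andP[/eqP fe es] /andP[/eqP fe' es'] E.
        apply/eqP; apply: contraT => /(fcp e e' es es').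
        by rewrite /compat E eqxx fe fe' eqxx.
      by move=> e; rewrite mem_filter => /andP[_ /subs/demandsP[]].
    have b5 : size B5 <= 3 * h by rewrite size_map size_filter demands_at_vertex.
    have b6 : size B6 <= slots by rewrite size_map size_filter loadP.
    rewrite /l !size_cat -cardE; move: b1 b2 b3 b4 b5 b6 cardX.
    move: (size B1) (size B2) (size B3) (size B4) (size B5) (size B6) #|X|.
    clear; lia.
  have [w wS] := exists_avoiding szl; rewrite /l !mem_cat !negb_or.
  case/and4P => wB1 wB2 wB3 /and4P[wB4 wB5 wB6]; rewrite mem_enum => wX.
  exists w; first apply/and3P; first split=> //.
    apply/negP => /mapP[e eF /set2_eq[] [E1 E2]].
      by case/negP: wB5; rewrite E2 map_f // mem_filter -E1 eqxx.
    by case/negP: wB6; rewrite E2; apply/mapP; exists e; rewrite // mem_filter -E1 eqxx.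
  move=> e es; apply/andP; split.
    apply/implyP => /eqP de; apply: contraNneq wB1 => ->.
    by rewrite map_f // mem_filter -de eqxx.
  apply/negP => /eqP/set2_eq[] [E1 E2].
    case ne: (near e.1.2 e.1.1).
      case/negP: wB2; rewrite E2 map_f // mem_filter es andbT /k E1.
      by rewrite /carrier ne.
    case/negP: wB3; rewrite E2 map_f // !mem_filter es ne /= andbT /k E1.
    by rewrite /carrier ne.
  by case/negP: wB4; rewrite E2 map_f // mem_filter es andbT -E1.
pose conn d := if near d.1.2 d.1.1 then [:: f d] else [:: y d; f d].
pose R2 := [seq [set carrier d; f d] | d <- demands].
pose R3 := [seq [set f d; d.1.1] | d <- demands].
have pR : perm_eq (flatten [seq connector_edges d.1.1 (d.1.2, conn d) | d <- demands])
    (R1 ++ R2 ++ R3).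
  rewrite /R1 /far_demands /R2 /R3; elim: demands => //= d s IH.
  have cE : connector_edges d.1.1 (d.1.2, conn d) =
      (if near d.1.2 d.1.1 then [::] else [:: [set d.1.2; y d]]) ++
      [:: [set carrier d; f d]; [set f d; d.1.1]].
    by rewrite /conn /carrier; case: ifP.
  apply/permP => P; have := permP IH P; rewrite cE.
  case: (near _ _) => /=; rewrite !count_cat /= ?count_cat /=;
    move: (count P) (nat_of_bool _) (nat_of_bool _) => cP p q; lia.
have okP d : d \in demands -> [/\ G (carrier d) (f d), G d.1.1 (f d), f d \notin X &
     [set carrier d; f d] \notin R1].
  by move=> /fok/and3P[]; rewrite !inE => /andP[].
exists conn; split.
- by move=> d; rewrite /conn; case: ifP.
- rewrite (perm_uniq pR) !cat_uniq; apply/and5P; split.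
  + rewrite map_inj_in_uniq; first exact: filter_uniq uniq_demands.
    move=> d e dF eF /set2_eq[] [E1 E2].
      have hE : d.1.1 = e.1.1.
        by have [_ _ _ <- _] := yP d dF; have [_ _ _ <- _] := yP e eF; rewrite E1 E2.
      apply/eqP; apply: contraT => /(f1cp d e dF eF)[_].
      rewrite -/(y d) -/(y e) E2 eqxx => /(_ _)/=; apply.
      by rewrite [d.1]surjective_pairing [e.1]surjective_pairing hE E1.
    have [_ _ _ h1 n1] := yP d dF; have [_ _ _ h2 _] := yP e eF.
    move: eF; rewrite mem_filter -h2 -E1 -E2 setUC h1.
    by rewrite n1.
  + rewrite has_cat negb_or; apply/andP; split; apply/hasPn => _ /mapP[d dD ->].
      by have [] := okP d dD.
    apply/negP => /mapP[e eF E]; have [_ uX yX _ _] := yP e eF.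
    have [xX _ _ _] := demandsP dD.
    by have /set2P[E'|E'] : d.1.1 \in [set e.1.2; y e] by [rewrite -E set22];
      rewrite E' in xX; [rewrite xX in uX | rewrite xX in yX].
  + rewrite map_inj_in_uniq ?uniq_demands // => d e dD eD E.
    apply/eqP; apply: contraT => /(fcp d e dD eD)/andP[_].
    by rewrite E eqxx.
  + apply/hasPn => _ /mapP[d dD ->]; apply/negP => /mapP[e eD E].
    have [xX _ _ _] := demandsP dD; have [_ _ fX _] := okP e eD.
    have cX := carX e eD.
    by have /set2P[E'|E'] : d.1.1 \in [set carrier e; f e] by [rewrite -E set22];
      rewrite E' in xX; [rewrite xX in cX | rewrite xX in fX].
  + rewrite map_inj_in_uniq ?uniq_demands // => d e dD eD /set2_eq[] [E1 E2].
      apply/eqP; apply: contraT => /(fcp d e dD eD)/andP[].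
      by rewrite E1 E2 !eqxx.
    have [xX _ _ _] := demandsP eD; have [_ _ fX _] := okP d dD.
    by rewrite E1 xX in fX.
- move=> e; rewrite (perm_mem pR) !mem_cat => /or3P[] /mapP[d dD ->]; rewrite in_edges.
  + by have [] := yP d dD.
  + by have [] := okP d dD.
  + by rewrite adj_sym; have [] := okP d dD.
Qed.

(** * Decomposing the whole graph *)

(** The edges that are left to the path decompositions of their hubs. *)
Definition served (e : {set T}) := [forall u in e, (u \notin X) &&
  (near u (hub e) || (heavy <= #|out (hub e) u|))].

Lemma edge_ends (e : {set T}) u : e \in edges G -> u \in e -> exists2 v, e = [set u; v] & G u v.
Proof.
case/imset2P => a b _; rewrite inE => ab -> /set2P[] ->; first by exists b.
by exists a; rewrite 1?setUC // adj_sym.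
Qed.

Lemma served_active (e : {set T}) u : e \in edges G -> served e -> u \in e ->
  active (hub e) u.
Proof.
move=> eE /forall_inP eS ue; have [v eV uv] := edge_ends eE ue.
have ve : v \in e by rewrite eV set22.
have /andP[uX uN] := eS u ue; have /andP[vX _] := eS v ve.
apply/and3P; split=> //.
  by rewrite eV; have [] := hub_near v uX.
by apply/set0Pn; exists v; rewrite inE uv uX vX -eV eqxx.
Qed.

(** Either the edge meets a hub, or one of its ends is far from its hub and has fewer
than [heavy] neighbours along edges attached to this hub. *)
Lemma card_unserved : #|[set e in edges G | ~~ served e]| <= h * #|T| + h * (#|T| * heavy).
Proof.
pose S1 := [set [set p.1; p.2] | p in setX X [set: T]].
pose S2 := \bigcup_(x in X) \bigcup_(u in [set: T])
   (if #|out x u| < heavy then [set [set u; y] | y in out x u] else set0).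
have c1 : #|S1| <= h * #|T|.
  by rewrite (leq_trans (leq_imset_card _ _)) // cardsX cardsT leq_mul.
have c2 : #|S2| <= h * (#|T| * heavy).
  apply: leq_trans (leq_mul cardX (leqnn _)); apply: card_bigcup_leq => x _.
  rewrite -[X in _ <= X * _]cardsT; apply: card_bigcup_leq => u _.
  case: ifP => [oK|_]; last by rewrite cards0.
  by rewrite (leq_trans (leq_imset_card _ _)) // ltnW.
apply: leq_trans (leq_add c1 c2); apply: leq_trans (leq_card_setU _ _).
apply/subset_leq_card/subsetP => e; rewrite inE => /andP[eE].
rewrite inE; have [eX _|] := boolP [exists u in e, u \in X].
  apply/orP; left; have /exists_inP[u ue uX] := eX.
  have [v -> _] := edge_ends eE ue.
  by apply/imsetP; exists (u, v); rewrite // !inE uX.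
move/exists_inPn => eX /forall_inPn[u ue]; rewrite eX //= negb_or -ltnNge => /andP[_ oK].
apply/orP; right; have [v eV uv] := edge_ends eE ue.
have ve : v \in e by rewrite eV set22.
have [hX _] := hub_near v (eX u ue).
apply/bigcupP; exists (hub e); first by rewrite eV.
apply/bigcupP; exists u => //; rewrite oK; apply/imsetP; exists v => //.
by rewrite inE uv !eX // -eV eqxx.
Qed.

(** The edges of the connecting walks are reserved first, and go with the served
edges attached to their hub; each of these groups is decomposed by [close_paths]. *)
Lemma decomposable_edges :
  decomposable (enum (edges G)) (h * (6 * #|T| + 3 * (3 * m)) + (h * #|T| + h * (#|T| * heavy))).
Proof.
have [conn [connS uR subR]] := reserve_connectors.
set R := flatten _ in uR subR.
pose pool x := [seq (d.1.2, conn d) | d <- demands & d.1.1 == x].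
pose Cx x := flatten (map (connector_edges x) (pool x)).
pose E' := [seq e <- enum (edges G) | (e \notin R) && served e].
pose F x := [seq e <- E' | hub e == x].
pose S := [seq e <- enum (edges G) | (e \notin R) && ~~ served e].
have mE' (e : {set T}) : (e \in E') = ((e \notin R) && served e) && (e \in edges G).
  by rewrite mem_filter mem_enum.
have mS (e : {set T}) : (e \in S) = ((e \notin R) && ~~ served e) && (e \in edges G).
  by rewrite mem_filter mem_enum.
have hubX (e : {set T}) : e \in E' -> hub e \in X.
  rewrite mE' => /andP[/andP[_ eS] eE].
  have [u ue] : exists u, u \in e by apply/card_gt0P; rewrite (eqP (card_edge eE)).
  by have /and3P[] := served_active eE eS ue.
have pR : perm_eq (flatten (map Cx (enum X))) R.
  have pd : perm_eq (flatten [seq [seq d <- demands | d.1.1 == x] | x <- enum X]) demands.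
    apply: perm_flatten_filter; first exact: enum_uniq.
    by move=> d /demandsP[]; rewrite mem_enum.
  have := perm_flatten (perm_map (fun d => connector_edges d.1.1 (d.1.2, conn d)) pd).
  apply: perm_trans; rewrite map_flatten.
  have -> : forall (ss : seq (seq (seq {set T}))), flatten (flatten ss) = flatten (map flatten ss).
    by elim=> //= s ss <-; rewrite flatten_cat.
  have CE x : Cx x =
      flatten [seq connector_edges d.1.1 (d.1.2, conn d) | d <- demands & d.1.1 == x].
    rewrite /Cx /pool -map_comp; congr flatten; apply/eq_in_map => d.
    by rewrite mem_filter => /andP[/eqP <- _].
  by rewrite (eq_map CE) -!map_comp; apply: perm_refl.
have pE : perm_eq (flatten [seq F x ++ Cx x | x <- enum X] ++ S) (enum (edges G)).
  apply: (@perm_trans _ ((E' ++ R) ++ S)).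
    rewrite perm_cat2r; apply: (perm_trans (perm_flatten_cat _ _ _)).
    apply: perm_cat pR; apply: perm_flatten_filter; first exact: enum_uniq.
    by move=> e eE'; rewrite mem_enum hubX.
  apply: uniq_perm; last 1 first.
  - move=> e; rewrite !mem_cat mE' mS mem_enum.
    case eR: (e \in R); first by rewrite subR.
    by case: (served e); rewrite ?orbF.
  - rewrite !cat_uniq uR !(filter_uniq _ (enum_uniq _)) andbT /=.
    rewrite andbT; apply/andP; split; apply/hasPn => e.
      by apply: contraTN; rewrite /= mE' => /andP[/andP[]].
    rewrite mS mem_cat mE' negb_or => /andP[/andP[/negbTE -> /negbTE ->] _].
    by rewrite andbF.
  - exact: enum_uniq.
apply: (decomposable_perm pE); apply: decomposable_cat; last first.
  apply: decomposable_leq (decomposable_singles _); apply: leq_trans card_unserved.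
  rewrite cardE; apply: uniq_leq_size; first by rewrite filter_uniq ?enum_uniq.
  by move=> e; rewrite mS mem_enum inE => /andP[/andP[_ ->] ->].
have := @decomposable_flatten T _ (fun x => F x ++ Cx x) (6 * #|T| + 3 * (3 * m)) (enum X).
move=> H; apply: decomposable_leq (H _) => {H}; first by rewrite -cardE leq_mul.
move=> x; rewrite mem_enum => xX.
have uFC : uniq (F x ++ Cx x).
  apply: (@uniq_flatten_mem _ _ (fun x => F x ++ Cx x) (enum X)); last by rewrite mem_enum.
  by have := enum_uniq (edges G); rewrite -(perm_uniq pE) cat_uniq => /and3P[].
have aFC : all (fun e : {set T} => #|e| == 2) (F x ++ Cx x).
  apply/allP => e eFC; apply: (@card_edge _ G); rewrite -mem_enum -(perm_mem pE) mem_cat.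
  apply/orP; left; apply/flattenP; exists (F x ++ Cx x) => //.
  by apply/mapP; exists x; rewrite ?mem_enum.
have [uF aF] : uniq (F x) /\ all (fun e : {set T} => #|e| == 2) (F x).
  by move: uFC aFC; rewrite cat_uniq all_cat => /andP[-> _] /andP[->].
have [Ps [isP pP szP endP]] := path_decomposition uF aF.
have pFC : perm_eq (all_edges Ps ++ Cx x) (F x ++ Cx x) by rewrite perm_cat2r.
apply: (decomposable_perm pFC).
have szpool : size (pool x) <= 3 * m.
  rewrite size_map size_filter.
  by apply: demands_at_hub => //; apply: uniq_demands.
apply: (@decomposable_leq _ _ (6 * size Ps + 3 * size (pool x))).
  by rewrite szP leq_add2l leq_mul2l szpool orbT.
apply: close_paths => //.
- by move=> _ /mapP[d _ ->]; apply: connS.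
- move=> v; have [/andP[_ v3] _] := endP v.
  have [->//|v0] := posnP (proper_ends Ps v).
  apply: leq_trans (_ : _ <= ends Ps v) _.
    rewrite /proper_ends /ends big_filter [X in _ <= X](bigID (fun p => 1 < size p)) /=.
    exact: leq_addr.
  apply: (leq_trans v3).
  have [p pPs [p1 pv]] : exists2 p, p \in Ps & 1 < size p /\ 0 < end_at p v.
    move: v0; rewrite lt0n /proper_ends /ends sum_nat_seq_neq0 => /hasP[p].
    by rewrite mem_filter /= -lt0n => /andP[p1 pPs] pv; exists p.
  have [e ep ve] := end_at_edge p1 pv.
  have : e \in F x by rewrite -(perm_mem pP) (mem_all_edges pPs).
  rewrite mem_filter mE' => /andP[/eqP hx /andP[/andP[_ eS] eE]].
  have actv := served_active eE eS ve; rewrite hx in actv.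
  rewrite count_map count_filter -size_filter.
  rewrite -[X in X <= _](size_enum_ord 3) -(size_map (fun c => (x, v, c))).
  apply: uniq_leq_size.
    by rewrite map_inj_uniq ?enum_uniq // => c c' [].
  move=> _ /mapP[c _ ->]; rewrite mem_filter /= !eqxx mem_filter /= actv.
  by rewrite mem_enum.
- by rewrite (perm_uniq pFC).
- by rewrite (perm_all _ pFC).
Qed.

End Reserve.

(** * The bound *)

Lemma card_edges_leq (T : finType) (G : sgraph T) : #|edges G| <= #|T| * #|T|.
Proof.
rewrite -card_prod -cardsT.
apply: leq_trans (leq_imset_card (fun p : T * T => [set p.1; p.2]) _).
apply/subset_leq_card/subsetP => e /imset2P[x y _ _ ->].
by apply/imsetP; exists (x, y).
Qed.

(** With [b = a^2], [q = n/r] and [L] slots: fewer vertices are excluded in the greedy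
choices of [reserve_connectors] than near vertices have common neighbours. *)
Lemma capacity_arith q L b h n : 0 < b -> q * (384 * b) <= n -> L * (64 * b) <= n ->
  256 * b * (h + 1) < n -> 8 * b * (3 * (2 * q.+1) + 2 * L + 8 * h) < n.
Proof. move=> *; nia. Qed.

(** With [b = a^2]: the slots of the candidates outnumber the demands. *)
Lemma slots_arith n b h L : n < L.+1 * (64 * b) -> 0 < L ->
  3 * (h * n) + 3 * L < (384 * h * b + 4) * L.
Proof.
move=> nL L0; have nL' : n <= 128 * b * L by nia.
have : h * n <= h * (128 * b * L) by rewrite leq_mul.
by lia.
Qed.

Lemma small_arith a k h : h = (k * a ^ 2) ^ 2 * (2 * a) ->
  256 * a ^ 2 * (h + 1) <= 256 * (2 * k ^ 2 + 1) * a ^ 12.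
Proof.
move=> ->; have [->|a0] := posnP a; first by rewrite !exp0n // !muln0.
have e7 : a ^ 7 <= a ^ 12 by rewrite leq_pexp2l.
have e2 : a ^ 2 <= a ^ 12 by rewrite leq_pexp2l.
have -> : 256 * a ^ 2 * ((k * a ^ 2) ^ 2 * (2 * a) + 1) =
          256 * (2 * k ^ 2 * a ^ 7 + a ^ 2) by rewrite expnMn -!expnM; lia.
by rewrite -[X in _ <= X]mulnA leq_mul // mulnDl mul1n leq_add // leq_mul.
Qed.

Lemma total_arith a k h n m : h = (k * a ^ 2) ^ 2 * (2 * a) -> m <= n ->
  h * (6 * n + 3 * (3 * m)) + (h * n + h * (n * (384 * h * a ^ 2 + 4))) <=
  (40 * k ^ 2 + 1536 * k ^ 4) * a ^ 12 * n.
Proof.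
move=> hE mn; have h5 : h = 2 * k ^ 2 * a ^ 5 by rewrite hE expnMn -!expnM; lia.
apply: (@leq_trans ((h * 20 + 384 * (h * h * a ^ 2)) * n)).
  have : h * m <= h * n by rewrite leq_mul.
  by lia.
rewrite leq_mul // h5.
have e5 : a ^ 5 <= a ^ 12.
  by have [->|a0] := posnP a; rewrite ?exp0n // leq_pexp2l.
have : k ^ 2 * a ^ 5 <= k ^ 2 * a ^ 12 by rewrite leq_mul.
have -> : a ^ 12 = a ^ 5 * a ^ 5 * a ^ 2 by rewrite -!expnD.
have -> : k ^ 4 = k ^ 2 * k ^ 2 by rewrite -!expnD.
move: (a ^ 5) (a ^ 2) (k ^ 2) => A B C; clear; lia.
Qed.

Lemma min_degree_leq (T : finType) (G : sgraph T) v : min_degree G <= degree G v.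
Proof.
rewrite /min_degree; have := mem_index_enum v; elim: (index_enum T) => // x s IH.
rewrite inE big_cons => /predU1P[->|/IH]; first exact: geq_minl.
by apply: leq_trans; apply: geq_minr.
Qed.

(** The parameters are [r = 384 a^2] blocks, [h = 2 a r^2] hubs, hence at most
[2 (n/r + 1)] vertices served by a hub, [slots = n/(64 a^2)], and [heavy] of order
[h a^2], the total number of demands divided by [slots]. *)
Lemma decomposition_leq : exists C0 : nat, forall (a : nat) (T : finType) (G : sgraph T),
  (forall v, #|T| <= a * degree G v) ->
  exists2 P, cycle_edge_decomposition G P & #|P| <= C0 * a ^ 12 * #|T|.
Proof.
(* The number 384 is kept abstract to prevent its powers from being computed in
   unary. *)
have [k k384] : exists k, k = 384 by exists 384.
exists (40 * k ^ 2 + 1536 * k ^ 4 + 256 * (2 * k ^ 2 + 1)) => a T G degG.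
pose n := #|T|; pose h := (k * a ^ 2) ^ 2 * (2 * a).
have [small|big] := leqP n (256 * a ^ 2 * (h + 1)).
  have dE : decomposable (enum (edges G)) (n * n).
    apply: decomposable_leq (decomposable_singles _).
    by rewrite -cardE card_edges_leq.
  have [P decP szP] := decomposable_partition dE.
  exists P => //; apply: (leq_trans szP); rewrite leq_mul //.
  apply: (leq_trans small); apply: (leq_trans (small_arith erefl)).
  by rewrite leq_mul // leq_addl.
have n0 : 0 < n by apply: leq_ltn_trans big.
have [x0 _] : exists x0 : T, x0 \in T by apply/card_gt0P.
have a0 : 0 < a.
  rewrite lt0n; apply: contraTneq n0 => a0.
  by have := degG x0; rewrite a0 mul0n -leqNgt.
have b0 : 0 < a ^ 2 by rewrite expn_gt0 a0.
pose r := k * a ^ 2; pose m := 2 * (n %/ r).+1; pose slots := n %/ (64 * a ^ 2).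
pose heavy := 384 * h * a ^ 2 + 4; pose common := 3 * m + 2 * slots + 8 * h.
have r0 : 0 < r by rewrite muln_gt0 k384.
have rE : n %/ r * r <= n := leq_trunc_div n r.
have LE : slots * (64 * a ^ 2) <= n := leq_trunc_div n _.
have LE2 : n < slots.+1 * (64 * a ^ 2) by apply: ltn_ceil; rewrite muln_gt0.
have commonE : 8 * a ^ 2 * common < n.
  by apply: capacity_arith => //; rewrite -k384.
have slots0 : 0 < slots.
  have c64 : 0 < 64 * a ^ 2 by rewrite muln_gt0.
  rewrite /slots divn_gt0 //; apply: leq_trans (ltnW big).
  by rewrite -[X in X <= _]muln1 leq_mul ?addn1 // leq_mul.
have [X [hub [cX hubX loadX]]] := hub_assignment degG x0 r0.
have nearP u x : near G a u x -> common < codegree G u x.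
  by move=> /(leq_trans commonE); rewrite ltn_mul2l => /andP[].
have heavyE : 3 * (h * n) + 3 * slots < heavy * slots by apply: slots_arith.
have mn : m <= n.
  apply: leq_trans (ltnW commonE); apply: (@leq_trans common); last first.
    by rewrite leq_pmull // muln_gt0.
  by rewrite /common -addnA; apply: leq_trans (leq_addr _ _); rewrite leq_pmull.
have dE := decomposable_edges nearP cX hubX loadX slots0 heavyE (leqnn common).
have [P decP szP] := decomposable_partition dE.
exists P => //; apply: (leq_trans szP); rewrite -/n.
apply: (leq_trans (total_arith erefl mn)).
by rewrite leq_mul // leq_mul // leq_addr.
Qed.

Import Order.TTheory GRing.Theory Num.Theory.
Local Open Scope ring_scope.

Theorem theorem1p4 (R : realType) :
  exists2 C : R, 0 < C &
    forall (c : R) (n : nat) (T : finType) (G : sgraph T),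
      0 < c < 1 -> #|T| = n ->
      c * n%:R <= (min_degree G)%:R ->
      exists2 P : {set {set {set T}}},
        cycle_edge_decomposition G P & #|P|%:R <= C * c ^- 12 * n%:R.
Proof.
have [C0 C0P] := decomposition_leq.
exists (C0.+1%:R * 2 ^+ 12) => [|c n T G /andP[c0 c1] Tn minG].
  by rewrite mulr_gt0 ?exprn_gt0 ?ltr0n.
pose a := (Num.truncn c^-1).+1.
have ci0 : 0 < c^-1 by rewrite invr_gt0.
have ci1 : 1 <= c^-1 by rewrite -invr1 lef_pV2 ?posrE ?ltW.
have lta : c^-1 < a%:R by rewrite truncnS_gt.
have ale : a%:R <= 2 * c^-1.
  rewrite /a -natr1 mulrDl mul1r lerD // truncn_le ltW //.
have degG v : (#|T| <= a * degree G v)%N.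
  rewrite Tn -(ler_nat R) natrM.
  have dv : (min_degree G)%:R <= (degree G v)%:R :> R.
    by rewrite ler_nat min_degree_leq.
  have ca : 1 <= a%:R * c by rewrite -ler_pdivrMr // div1r ltW.
  apply: (@le_trans _ _ (a%:R * (c * n%:R))); last first.
    by rewrite ler_wpM2l // (le_trans minG).
  by rewrite mulrA ler_peMl.
have [P decP leP] := C0P a T G degG.
exists P => //; apply: (@le_trans _ _ (C0 * a ^ 12 * #|T|)%:R); first by rewrite ler_nat.
rewrite 2!natrM natrX Tn ler_wpM2r // -mulrA ler_pM ?exprn_ge0 ?ler_nat //.
by rewrite -exprVn -exprMn lerXn2r ?nnegrE // mulr_ge0 // ltW.
Qed.
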